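(* Let $\Sigma$ be a monoid, $A\colon\Sigma\to\mathfrak{gl}(V)$ a representation of $\Sigma$ on a finite-dimensional real vector space $V$, and $x_0\in V$ a $\Sigma$-symmetric point, i.e. $A_\sigma x_0=x_0$ for all $\sigma\in\Sigma$. Consider smooth one-parameter families of $\Sigma$-equivariant vector fields $F\colon V\times\mathbb{R}\to V$, i.e. $F(A_\sigma x,\lambda)=A_\sigma F(x,\lambda)$ for all $x\in V$, $\lambda\in\mathbb{R}$, $\sigma\in\Sigma$, such that $F(x_0,\lambda)=0$ for all $\lambda\in\mathbb{R}$. Then steady state bifurcations from $x_0$ in such families generically occur along an absolutely indecomposable subrepresentation. That is, for generic $F$ the following holds: for every $\lambda_0\in\mathbb{R}$ at which the linearization $D_xF(x_0,\lambda_0)$ is not invertible, the generalized kernel of $D_xF(x_0,\lambda_0)$ is an absolutely indecomposable subrepresentation of $V$.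
   Context: A monoid is a set with an associative multiplication and a neutral element $1$; no finiteness or compactness is assumed. A representation of $\Sigma$ on a finite-dimensional real vector space $V$ is a map $A\colon\Sigma\to\mathfrak{gl}(V)$ into the space of all linear maps $V\to V$ (not necessarily invertible) with $A_{\sigma\sigma'}=A_\sigma A_{\sigma'}$ for all $\sigma,\sigma'$ and $A_1=\mathrm{id}_V$. A subrepresentation is a linear subspace $W\subset V$ with $A_\sigma W\subset W$ for all $\sigma\in\Sigma$. A nonzero representation is indecomposable if it is not the direct sum of two proper subrepresentations. For a representation $W$, $\operatorname{End}_\Sigma(W)$ is the real algebra of linear maps $W\to W$ commuting with the action of $\Sigma$, and $\operatorname{End}_\Sigma^{\mathrm{nil}}(W)$ is the set of its nilpotent elements. For $W$ indecomposable, $\operatorname{End}_\Sigma^{\mathrm{nil}}(W)$ is an ideal and $\operatorname{End}_\Sigma(W)/\operatorname{End}_\Sigma^{\mathrm{nil}}(W)$ is a finite-dimensional real associative division algebra, hence isomorphic to $\mathbb{R}$, $\mathbb{C}$ or $\mathbb{H}$; $W$ is called absolutely indecomposable if this quotient is isomorphic to $\mathbb{R}$. The generalized kernel of a linear map $L\colon V\to V$ is $\ker L^{\dim V}$. For $F$ as in the claim, $D_xF(x_0,\lambda)\in\operatorname{End}_\Sigma(V)$ and its generalized kernel is a subrepresentation. Branches of steady states can bifurcate from $x_0$ only at parameter values $\lambda_0$ where $D_xF(x_0,\lambda_0)$ is not invertible; the bifurcation at $\lambda_0$ is said to occur along the generalized kernel of $D_xF(x_0,\lambda_0)$. ''For generic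 $F$'' means: for all $F$ in a residual subset (one containing a countable intersection of open dense sets) of the space of all smooth $\Sigma$-equivariant $F\colon V\times\mathbb{R}\to V$ with $F(x_0,\lambda)=0$ for all $\lambda$, equipped with the $C^\infty$ compact-open topology (uniform convergence of all derivatives on compact sets). *)

(* Defs.v *)
From HB Require Import structures.
From mathcomp Require Import all_boot all_order all_algebra.
From mathcomp Require Import all_classical all_reals all_analysis.

Set Implicit Arguments.
Unset Strict Implicit.
Unset Printing Implicit Defensive.

Import Order.TTheory GRing.Theory Num.Theory.
Import numFieldNormedType.Exports.

Local Open Scope classical_set_scope.
Local Open Scope ring_scope.

(* Finite-dimensional real vector spaces.  The norm only serves to make the
   library's differential calculus available: all norms on such a space are
   equivalent, so that no notion below depends on it. *)
#[short(type="finNormedModType")]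
HB.structure Definition FinNormedModule (R : realType) :=
  {V of NormedModule R V & Vector R V}.

HB.instance Definition _ (R : realType) (m n : nat) :=
  NormedModule.on 'M[R]_(m, n).

Section Representations.
Context {R : realType} {S : monoidType} {U : vectType R}.
Implicit Types (A : S -> 'End(U)) (W : {vspace U}) (f g : 'End(U)).

Definition representation A :=
  A 1%g = \1%VF /\ forall s t : S, A (s * t)%g = (A s \o A t)%VF.

Definition subrepresentation A W := forall s : S, (A s @: W <= W)%VS.

Definition indecomposable A :=
  {:U}%VS <> 0%VS /\
  ~ exists W1 W2 : {vspace U},
      [/\ subrepresentation A W1, subrepresentation A W2,
          W1 <> {:U}%VS, W2 <> {:U}%VS &
          (W1 + W2)%VS = {:U}%VS /\ (W1 :&: W2)%VS = 0%VS].

(* 'End(U) carries a ring structure in the library only when U is nonzero,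
   hence the explicit iteration. *)
Definition lfun_pow f (k : nat) : 'End(U) := iter k (comp_lfun f) \1%VF.

Definition equivariant_end A : set 'End(U) :=
  [set f | forall s : S, (f \o A s)%VF = (A s \o f)%VF].

Definition nilpotent_end A : set 'End(U) :=
  [set f | equivariant_end A f /\ exists k, lfun_pow f k = 0].

Definition nilpotent_coset A f : set 'End(U) :=
  [set g | equivariant_end A g /\ nilpotent_end A (g - f)].

Definition end_mod_nilpotent A : set (set 'End(U)) :=
  nilpotent_coset A @` equivariant_end A.

(* psi is an isomorphism of real algebras from the quotient, whose operations
   are those of representatives, onto R. *)
Definition end_mod_nilpotent_iso_R A := exists psi : set 'End(U) -> R,
  [/\ set_bij (end_mod_nilpotent A) [set: R] psi,
      psi (nilpotent_coset A \1%VF) = 1,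
      {in equivariant_end A &, forall f g,
        psi (nilpotent_coset A (f + g)) =
        psi (nilpotent_coset A f) + psi (nilpotent_coset A g)},
      {in equivariant_end A &, forall f g,
        psi (nilpotent_coset A (f \o g)%VF) =
        psi (nilpotent_coset A f) * psi (nilpotent_coset A g)} &
      forall a : R, {in equivariant_end A, forall f,
        psi (nilpotent_coset A (a *: f)) = a * psi (nilpotent_coset A f)}].

Definition absolutely_indecomposable A :=
  indecomposable A /\ end_mod_nilpotent_iso_R A.

Definition restriction A W (s : S) : 'End(subvs_of W) :=
  (linfun (vsproj W) \o A s \o linfun vsval)%VF.

Lemma restrictionE A W s (w : subvs_of W) :
  subrepresentation A W -> vsval (restriction A W s w) = A s (vsval w).
Proof.
move=> AW; rewrite /restriction !comp_lfunE !lfunE /= vsprojK//.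
by apply: (subvP (AW s)); rewrite memv_img ?subvsP.
Qed.

Definition generalized_kernel f : {vspace U} := lker (lfun_pow f (\dim {:U})).

End Representations.

Section SmoothMaps.
Context {R : realType} {V W : normedModType R}.

(* The iterated directional derivative D_(v1) (... (D_(vk) F)), for
   vs = [:: v1; ...; vk]. *)
Definition iter_derive (F : V -> W) (vs : seq V) : V -> W :=
  foldr (fun v G => 'D_v G) F vs.

Definition smooth (F : V -> W) :=
  forall (vs : seq V) (x : V), differentiable (iter_derive F vs) x.

End SmoothMaps.

Section Families.
Context {R : realType} {S : monoidType} {V : finNormedModType R}.
Variables (A : S -> 'End(V)) (x0 : V).

Definition equivariant_families : set (V * R -> V) :=
  [set F | [/\ smooth F,
     forall (s : S) (x : V) (l : R), F (A s x, l) = A s (F (x, l)) &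
     forall l : R, F (x0, l) = 0]].

(* The C^oo compact-open topology: the coarsest one for which F |-> D_vs F is
   continuous, for all vs, into the maps with uniform convergence on compact
   sets.  By multilinearity in vs, this is uniform convergence on compact sets
   of each total derivative. *)
Definition all_derivatives (F : equivariant_families) :
    prod_topology
      (fun _ : seq (V * R) => {family compact, (V * R)%type -> V}) :=
  fun vs => iter_derive (set_val F) vs.

Definition family_space := initial_topology all_derivatives.

Definition linearization (F : V * R -> V) (l : R) : 'End(V) :=
  linfun ('d (fun x : V => F (x, l)) x0).

End Families.

Definition residual (T : topologicalType) (A : set T) :=
  exists O : nat -> set T,
    (forall i, open (O i) /\ dense (O i)) /\ \bigcap_i O i `<=` A.

(* Main.v *)
(** The linearizations [L l] of an equivariant family form a C^1 path in the
algebra of equivariant endomorphisms. Let [m] be the maximal number of distinct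
complex eigenvalues of an equivariant endomorphism. If [M] attains [m], then the
generalized kernel [W] of [M] is absolutely indecomposable: an equivariant
endomorphism of [W] with two distinct eigenvalues could replace, after scaling,
[M] on [W] and yield more than [m] eigenvalues; so every equivariant
endomorphism of [W] is a real scalar plus a nilpotent.

Attaining [m] is the non-vanishing of a Hankel determinant [hankel m M] of the
traces of the powers of [M]. It remains to see that, for families forming an
open dense set, [hankel m (L l)] and [\det (L l)] do not vanish simultaneously
for [l] in a compact interval. Density is obtained from constant perturbations
[L l + c *: M0 + s%:M], where [M0] attains [m]: by a one-dimensional Sard
argument and Baire's theorem, for suitable small [c] the Hankel determinant
vanishes for countably many [l] only, whatever [s] is, and [s] is then chosen
such that the determinant does not vanish at these [l]. *)

From HB Require Import structures.
Require Import Defs.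
From mathcomp Require Import all_boot all_order all_algebra.
From mathcomp Require Import all_classical all_reals all_analysis.
From mathcomp Require Import complex spectral.
From mathcomp Require Import ring lra.

Set Implicit Arguments.
Unset Strict Implicit.
Unset Printing Implicit Defensive.

Import Order.TTheory GRing.Theory Num.Theory.
Import numFieldNormedType.Exports VectorInternalTheory.

Local Open Scope classical_set_scope.
Local Open Scope ring_scope.

(** * Eigenvalues and Hankel determinants *)

Section Eigenvalues.
Context {R : rcfType}.
Implicit Types (n m : nat) (a c s : R) (w z : R[i]).
Local Notation toC := (real_complex R).
Local Notation mxC := (map_mx toC).

(** Schur's theorem conjugates [M] to a triangular matrix [T], and [rs] is the diagonal of [T]: the
    eigenvalues of [M] with multiplicity. The powers of [T] stay triangular, with the powers of
    these entries on the diagonal. *)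
Lemma mxtrace_pow_eigenvalues n (M : 'M[R[i]]_n) : exists rs : seq R[i],
  (forall z, (z \in rs) = eigenvalue M z) /\
  forall k, \tr (M ^+ k) = \sum_(z <- rs) z ^+ k.
Proof.
case: n M => [|n] M.
  exists [::]; split=> [z|k]; last by rewrite big_nil /mxtrace big_ord0.
  rewrite in_nil; apply/esym/negbTE/eigenvalueP => -[v _].
  by rewrite [v]thinmx0 eqxx.
have [P /unitarymx_unit Pu] := Schur M isT.
rewrite /similar_to conjumx// => trigT; set T := P *m M *m invmx P in trigT.
have powT k : P *m (M ^+ k) *m invmx P = T ^+ k.
  elim: k => [|k IH]; first by rewrite !expr0 mulmx1 mulmxV.
  by rewrite !exprSr -IH /T -!mulmxE !mulmxA mulmxKV.
have diagT k : is_trig_mx (T ^+ k) /\ forall i, (T ^+ k) i i = T i i ^+ k.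
  elim: k => [|k [IHt IHd]].
    by rewrite expr0; split=> [|i]; rewrite ?scalar_mx_is_trig// mxE eqxx.
  have dT i : (T ^+ k.+1) i i = T i i ^+ k.+1.
    rewrite !exprSr -mulmxE mxE (bigD1 i)//= IHd big1 ?addr0// => j jNi.
    have [ij|ji|/val_inj eij] := ltngtP i j; last by rewrite eij eqxx in jNi.
      by rewrite (is_trig_mxP IHt)// mul0r.
    by rewrite (is_trig_mxP trigT)// mulr0.
  split=> //; apply/is_trig_mxP => i j ij; rewrite exprSr -mulmxE mxE big1// => l _.
  have [il|li] := ltnP i l; first by rewrite (is_trig_mxP IHt)// mul0r.
  by rewrite (is_trig_mxP trigT) ?mulr0// (leq_ltn_trans li).
exists [seq T i i | i <- enum 'I_n.+1]; split=> [z|k].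
  have -> : eigenvalue M z = eigenvalue T z.
    apply/eigenvalueP/eigenvalueP => -[v vz v0].
      exists (v *m invmx P); last first.
        apply: contra_neq v0 => v0.
        by rewrite -[v](mulmxKV Pu) v0 mul0mx.
      by rewrite /T !mulmxA mulmxKV// vz scalemxAl.
    exists (v *m P); last first.
      by apply: contra_neq v0 => v0; rewrite -[v](mulmxK Pu) v0 mul0mx.
    by rewrite scalemxAl -vz /T !mulmxA mulmxKV.
  rewrite eigenvalue_root_char char_poly_trig//.
  have <- : \prod_(x <- [seq T i i | i <- enum 'I_n.+1]) ('X - x%:P) =
      \prod_(i < n.+1) ('X - (T i i)%:P) by rewrite big_map big_enum.
  by rewrite root_prod_XsubC.
rewrite big_map big_enum -[M ^+ k](mulKmx Pu) mxtrace_mulC powT.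
by apply: eq_bigr => i _; have [_ ->] := diagT k.
Qed.

Lemma eigenvalue_seq n (M : 'M[R]_n) :
  {s : seq R[i] | uniq s & forall z, (z \in s) = eigenvalue (mxC M) z}.
Proof.
have [rs Ers] := closed_field_poly_normal (char_poly (mxC M)).
exists (undup rs) => [|z]; first exact: undup_uniq.
rewrite mem_undup eigenvalue_root_char Ers rootZ ?root_prod_XsubC//.
by rewrite lead_coef_eq0 monic_neq0 ?char_poly_monic.
Qed.

(** Distinct complex eigenvalues of a real matrix, in an arbitrary order; only membership and their
    number matter below. *)
Definition eigs n (M : 'M[R]_n) : seq R[i] := s2val (eigenvalue_seq M).

Lemma mem_eigs n (M : 'M[R]_n) z : (z \in eigs M) = eigenvalue (mxC M) z.
Proof. exact: (s2valP' (eigenvalue_seq M)). Qed.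

Lemma eigsP n (M : 'M[R]_n) z :
  reflect (exists2 v : 'rV_n, v *m mxC M = z *: v & v != 0) (z \in eigs M).
Proof. by rewrite mem_eigs; exact: eigenvalueP. Qed.

Lemma eigs_uniq n (M : 'M[R]_n) : uniq (eigs M).
Proof. exact: (s2valP (eigenvalue_seq M)). Qed.

Lemma size_eigs n (M : 'M[R]_n) : (size (eigs M) <= n)%N.
Proof.
rewrite -ltnS -(size_char_poly (mxC M)) max_poly_roots ?eigs_uniq//.
  by rewrite monic_neq0 ?char_poly_monic.
by apply/allP => z; rewrite mem_eigs eigenvalue_root_char.
Qed.

(** For [m] equal to [n] this is the discriminant of the characteristic polynomial of [M]. *)
Definition hankel m n (M : 'M[R]_n) : R :=
  \det (\matrix_(i < m, j < m) \tr (M ^+ (i + j))).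

(* Over the complex numbers the Hankel matrix of the power sums is
   [V^T *m D *m V] with [V] the Vandermonde matrix of the distinct eigenvalues
   and [D] the diagonal matrix of their multiplicities. *)
Lemma hankel_neq0 m n (M : 'M[R]_n) : (size (eigs M) <= m)%N ->
  (hankel m M != 0) = (size (eigs M) == m).
Proof.
move=> szm; have [rs [rsE trE]] := mxtrace_pow_eigenvalues (mxC M).
have es_rs : eigs M =i undup rs by move=> z; rewrite mem_eigs mem_undup rsE.
have szE : size (eigs M) = size (undup rs).
  by apply/eqP; rewrite -uniq_size_uniq ?eigs_uniq ?undup_uniq.
pose d := size (eigs M).
pose z_ (l : 'I_d) : R[i] := (undup rs)`_l.
pose V : 'M[R[i]]_(d, m) := \matrix_(l, i) z_ l ^+ i.
pose D : 'rV[R[i]]_d := \row_l (count_mem (z_ l) rs)%:R.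
have hE : map_mx toC (\matrix_(i < m, j < m) \tr (M ^+ (i + j))) =
    V^T *m diag_mx D *m V.
  apply/matrixP => i j; rewrite !mxE -trace_map_mx rmorphXn/= trE.
  rewrite -big_undup_iterop_count/= (big_nth 0) -szE big_mkord.
  apply: eq_bigr => l _; rewrite mul_mx_diag !mxE.
  by rewrite -/(z_ l) Monoid.iteropE iter_addr_0 exprD mulrAC mulr_natr.
have zinj : injective z_.
  move=> l l' /eqP; rewrite nth_uniq -?szE ?ltn_ord ?undup_uniq//.
  by move/eqP/val_inj.
rewrite /hankel -(fmorph_eq0 toC) -det_map_mx hE.
(* With fewer than [m] eigenvalues the factorization has rank below [m]; with exactly [m], all three
   factors are square and invertible. *)
have [eqm|neqm] := eqVneq d m; last first.
  have ltm : (d < m)%N by rewrite ltn_neqAle neqm.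
  apply/negbTE; rewrite negbK; apply/det0P.
  have : (\rank (V^T *m diag_mx D *m V) < m)%N.
    by rewrite (leq_ltn_trans (mxrankM_maxr _ _))// (leq_ltn_trans (rank_leq_row _)).
  move=> rk; have : kermx (V^T *m diag_mx D *m V) != 0.
    by rewrite -mxrank_eq0 mxrank_ker -lt0n subn_gt0.
  move=> /rowV0Pn[v /sub_kermxP vk v0]; by exists v.
have VE l i : V l i = z_ l ^+ i by rewrite mxE.
case: m / eqm V VE hE {szm} => V VE hE.
have detV : \det V != 0.
  have -> : V = (Vandermonde d (\row_l z_ l))^T.
    by apply/matrixP => i j; rewrite VE !mxE.
  rewrite det_tr det_Vandermonde; apply/prodf_neq0 => i _.
  apply/prodf_neq0 => j ij; rewrite !mxE subr_eq0.
  by apply/eqP => /zinj eji; rewrite eji ltnn in ij.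
rewrite !det_mulmx det_tr det_diag !mulf_neq0//.
apply/prodf_neq0 => l _; rewrite mxE pnatr_eq0 -lt0n -has_count has_pred1.
by rewrite -mem_undup mem_nth// -szE.
Qed.

(** The map [z |-> c z + s] is a bijection between the two spectra. *)
Lemma eigs_affine n (M : 'M[R]_n) c s : c != 0 ->
  size (eigs (c *: M + s%:M)) = size (eigs M).
Proof.
move=> c0; have cC0 : toC c != 0 by rewrite fmorph_eq0.
rewrite -[RHS](size_map (fun z => toC c * z + toC s)); apply/eqP.
rewrite -uniq_size_uniq ?eigs_uniq//.
  by rewrite map_inj_uniq ?eigs_uniq// => x y /addIr/(mulfI cC0).
have mC : mxC (c *: M + s%:M) = toC c *: mxC M + (toC s)%:M.
  by rewrite map_mxD map_mxZ map_scalar_mx.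
have eE z : (toC c * z + toC s \in eigs (c *: M + s%:M)) = (z \in eigs M).
  rewrite !mem_eigs mC; apply/eigenvalueP/eigenvalueP => -[v vz v0]; exists v => //.
    apply: (scalerI cC0); apply: (addIr (toC s *: v)).
    by move: vz; rewrite mulmxDr -scalemxAr mul_mx_scalar scalerDl scalerA.
  by rewrite mulmxDr -scalemxAr mul_mx_scalar vz scalerDl scalerA.
move=> z; apply/mapP/idP => [[w wM ->]|zM]; first by rewrite eE.
exists ((toC c)^-1 * (z - toC s)); last by rewrite mulVKf// subrK.
by rewrite -eE mulVKf// subrK.
Qed.

Lemma natr_notin (F : numDomainType) (s : seq F) :
  exists2 k, (0 < k)%N & k%:R \notin s.
Proof.
have [/hasP[k]|/hasPn all_s] :=
    boolP (has (fun k => k%:R \notin s) (iota 1 (size s).+1)).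
  by rewrite mem_iota => /andP[k0 _] ks; exists k.
have : (size [seq (k%:R : F) | k <- iota 1 (size s).+1] <= size s)%N.
  apply: uniq_leq_size.
    by rewrite map_inj_uniq ?iota_uniq// => i j /eqP; rewrite eqr_nat => /eqP.
  by move=> _ /mapP[k ks ->]; have := all_s _ ks; rewrite negbK.
by rewrite size_map size_iota ltnn.
Qed.

(** The characteristic polynomial is then [X^n], and Cayley-Hamilton applies. *)
Lemma nilpotent_eigenvalue0 n (M : 'M[R]_n) :
  (forall z, eigenvalue (mxC M) z -> z = 0) -> M ^+ n = 0.
Proof.
case: n M => [|n] M M0; first by rewrite [LHS]thinmx0 [RHS]thinmx0.
have [rs Ers] := closed_field_poly_normal (char_poly (mxC M)).
have {Ers} Ers : char_poly (mxC M) = \prod_(z <- rs) ('X - z%:P).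
  by rewrite Ers (monicP (char_poly_monic _)) scale1r.
have rs0 z : z \in rs -> z = 0.
  by move=> zrs; apply: M0; rewrite eigenvalue_root_char Ers root_prod_XsubC.
have Xn : char_poly (mxC M) = 'X^(size rs).
  have rsE : rs = nseq (size rs) 0 by apply/all_pred1P/allP => z /rs0/eqP.
  by rewrite Ers [in LHS]rsE big_nseq subr0 iter_mulr_1.
have := size_char_poly (mxC M); rewrite Xn size_polyXn => -[szrs].
have := Cayley_Hamilton (mxC M); rewrite Xn szrs rmorphXn/= horner_mx_X.
by move=> /eqP; rewrite -rmorphXn/= map_mx_eq0 => /eqP.
Qed.

(* The kernel of [M ^+ n] has an equivariant complement because its projection
   is a polynomial in [M]. *)
Lemma generalized_kernel_projection n (M : 'M[R]_n) : exists P : 'M[R]_n,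
  [/\ P *m P = P, P *m M ^+ n = 0,
      forall B, M *m B = B *m M -> P *m B = B *m P &
      forall v : 'rV_n, v *m M ^+ n = 0 -> v *m P = v].
Proof.
case: n M => [|n] M.
  by exists 0; split=> [||B _|v _]; rewrite ?mul0mx ?mulmx0// [RHS]thinmx0.
have p0 : char_poly M != 0 by rewrite monic_neq0 ?char_poly_monic.
have [k [q q0 pE]] := multiplicity_XsubC (char_poly M) 0.
rewrite p0/= in q0; rewrite subr0 in pE.
have kn : (k <= n.+1)%N.
  rewrite -ltnS -[X in (_ < X)%N](size_char_poly M) -(size_polyXn R k).
  by rewrite pE dvdp_leq ?dvdp_mull// -pE.
(* The characteristic polynomial is [q X^k] with [q] prime to [X], so that [u q + v X^(n+1) = 1].
   The matrix [P = (u q)(M)] is killed by [M ^+ n.+1] by Cayley-Hamilton, and is the identity where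
   [M ^+ n.+1] vanishes. *)
have /Bezout_eq1_coprimepP[[u v]/= uv] : coprimep q 'X^(n.+1).
  by rewrite coprimep_expr// -[X in coprimep _ X]subr0 coprimep_XsubC.
pose P := horner_mx M (u * q).
have qX : horner_mx M (q * 'X^(n.+1)) = 0.
  rewrite -(subnKC kn) exprD mulrA -pE rmorphM/=.
  by rewrite Cayley_Hamilton mul0r.
have qM : P *m M ^+ n.+1 = 0.
  rewrite /P -[X in X ^+ n.+1](horner_mx_X M).
  rewrite -rmorphXn/= mulmxE -rmorphM/= -mulrA rmorphM/= qX mulr0//.
have P1 : P = 1 - horner_mx M v *m M ^+ n.+1.
  rewrite /P -[X in X ^+ n.+1](horner_mx_X M) -rmorphXn/= mulmxE -rmorphM/=.
  by rewrite -(rmorph1 (horner_mx M)) -rmorphB/= -uv addrK.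
have comm : GRing.comm P (horner_mx M v).
  by rewrite /GRing.comm -!rmorphM/= mulrC.
exists P; split=> // [|B MB|w wM].
- by rewrite [in X in _ *m X]P1 mulmxBr mulmx1 mulmxA [P *m _]comm -mulmxA qM
    mulmx0 subr0.
- exact: comm_horner_mx.
- suff -> : P = 1 - M ^+ n.+1 *m horner_mx M v.
    by rewrite mulmxBr mulmx1 mulmxA wM mul0mx subr0.
  rewrite P1; congr (_ - _); rewrite -[X in X ^+ n.+1](horner_mx_X M).
  by rewrite -rmorphXn/= !mulmxE -!rmorphM/= mulrC.
Qed.

(** Matrices act on row vectors. For a projection [P] commuting with [J], these are the eigenvalues
    of [J] on the complexified image of [P]; they leave out the zero eigenvalue that [J] may have on
    the complement. *)
Definition proj_eigenvalue n (P J : 'M[R]_n) z :=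
  exists v : 'rV[R[i]]_n, [/\ v != 0, v *m mxC P = v & v *m mxC J = z *: v].

(** Start from a nonzero vector fixed by [P] and apply the linear factors [J - z] of the
    characteristic polynomial one after the other. All intermediate vectors stay fixed by [P]
    because [J *m P = J], and the last nonzero one is an eigenvector. *)
Lemma proj_eigenvalue_ex n (P J : 'M[R]_n) : P *m P = P -> P != 0 -> J *m P = J ->
  exists z, proj_eigenvalue P J z.
Proof.
case: n P J => [|m] Q J QQ Q0 JQ; first by rewrite [Q]thinmx0 eqxx in Q0.
have [rs Ers] := closed_field_poly_normal (char_poly (mxC J)).
have {Ers} Ers : char_poly (mxC J) = \prod_(z <- rs) ('X - z%:P).
  by rewrite Ers (monicP (char_poly_monic _)) scale1r.
have JQC : mxC J *m mxC Q = mxC J by rewrite -map_mxM JQ.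
have [v v0 vQ] : exists2 v : 'rV[R[i]]_m.+1, v != 0 & v *m mxC Q = v.
  have /rowV0Pn[v /submxP[u uE] v0] : mxC Q != 0 by rewrite map_mx_eq0.
  by exists v => //; rewrite uE -mulmxA -map_mxM QQ.
have := Cayley_Hamilton (mxC J); rewrite Ers rmorph_prod/=.
move=> /(congr1 (mulmx v)); rewrite mulmx0.
elim: rs v v0 vQ {Ers} => [|z rs IH] v v0 vQ.
  by rewrite big_nil mulmx1 => v00; rewrite v00 eqxx in v0.
rewrite big_cons -mulmxE mulmxA rmorphB/= horner_mx_X horner_mx_C.
have [vz _|vz] := eqVneq (v *m (mxC J - z%:M)) 0; last first.
  by apply: IH => //; rewrite mulmxBr mulmxBl -mulmxA JQC mul_mx_scalar
    -scalemxAl vQ.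
exists z, v; split=> //; apply/eqP; rewrite -subr_eq0 -mul_mx_scalar -mulmxBr.
by rewrite vz.
Qed.

Lemma proj_eigenvalue_conj n (P J : 'M[R]_n) z :
  proj_eigenvalue P J z -> proj_eigenvalue P J (z^*)%C.
Proof.
move=> [v [v0 vP vJ]]; exists (map_mx (fun x : R[i] => (x^*)%C) v).
have cC (Q : 'M[R]_n) :
    map_mx (fun x : R[i] => (x^*)%C) (mxC Q) = mxC Q.
  by apply/matrixP => i j; rewrite !mxE/= oppr0.
split; first by rewrite map_mx_eq0.
- by rewrite -[in LHS]cC -map_mxM vP.
- by rewrite -[in LHS]cC -map_mxM vJ map_mxZ.
Qed.

(** An eigenvector of [J - a *: P] for a nonzero [z] lies in the image of [P], where it is an
    eigenvector of [J] for [z + a]; hence [z = 0]. *)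
Lemma proj_eigenvalue_nilpotent n (P J : 'M[R]_n) a : P *m P = P ->
  P *m J = J -> J *m P = J ->
  (forall z, proj_eigenvalue P J z -> z = toC a) -> (J - a *: P) ^+ n = 0.
Proof.
move=> PP PJ JP Ja; apply: nilpotent_eigenvalue0 => z /eigenvalueP[v vz v0].
apply/eqP/negPn/negP => z0.
have vP : v *m mxC P = v.
  apply: (scalerI z0); rewrite scalemxAl -vz -mulmxA -map_mxM mulmxBl.
  by rewrite -scalemxAl PP JP.
have : proj_eigenvalue P J (z + toC a).
  exists v; split=> //; move: vz; rewrite map_mxB map_mxZ mulmxBr -scalemxAr vP.
  by move=> /(canRL (subrK _)) ->; rewrite scalerDl.
by move/Ja => /(canRL (addrK _)); rewrite subrr => /eqP; rewrite (negbTE z0).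
Qed.

(* Two distinct eigenvalues of [J] on the generalized kernel of [M] would
   produce, by replacing [M] there by a suitable multiple of [J], a matrix with
   more eigenvalues than [M]. *)
Lemma proj_eigenvalue_unique n (M P J : 'M[R]_n) z z' :
  P *m P = P -> P *m M = M *m P -> P *m M ^+ n = 0 -> P *m J = J -> J *m P = J ->
  (forall e, size (eigs (M - P *m M + e *: J)) <= size (eigs M))%N ->
  proj_eigenvalue P J z -> proj_eigenvalue P J z' -> z = z'.
Proof.
move=> PP PM PMn PJ JP maxM Jz Jz'; apply/eqP/negPn/negP => zz'.
pose nz := [seq w <- eigs M | w != 0].
have szM : (size (eigs M) <= (size nz).+1)%N.
  rewrite size_filter -(count_predC (fun w => w != 0) (eigs M)) -addn1 leq_add2l.
  rewrite (@eq_count _ _ (pred1 0)) => [|w /=]; last by rewrite negbK.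
  by rewrite count_uniq_mem ?eigs_uniq// leq_b1.
(* The factor [e = k] keeps [e z] and [e z'] away from the nonzero eigenvalues of [M]. If one of the
   two is zero, it is absent from [nz] anyway. *)
have [k k0 kN] := natr_notin ([seq w / z | w <- nz] ++ [seq w / z' | w <- nz]).
set e := k%:R : R; have eC : toC e = k%:R by rewrite rmorph_nat.
have eC0 : toC e != 0 by rewrite eC pnatr_eq0 -lt0n.
have [X XE] : {X | X = M - P *m M + e *: J} by exists (M - P *m M + e *: J).
have {}maxM : (size (eigs X) <= size (eigs M))%N by rewrite XE.
have XC v : v *m mxC X = v *m mxC M - v *m mxC P *m mxC M + toC e *: (v *m mxC J).
  by rewrite XE map_mxD map_mxB map_mxM map_mxZ mulmxDr mulmxBr mulmxA scalemxAr.
have Xe w : proj_eigenvalue P J w -> toC e * w \in eigs X.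
  move=> [v [v0 vP vJ]]; apply/eigsP; exists v => //.
  by rewrite XC vP subrr add0r vJ scalerA.
have Xnz w : w \in nz -> w \in eigs X.
  rewrite mem_filter => /andP[w0 /eigsP[v vw v0]].
  apply/eigsP; exists v => //.
  (* An eigenvector of [M] for [w != 0] has no component in the generalized kernel:
     [w^n v P = v M^n P = v P M^n = 0]. Replacing [M] there does not affect it. *)
  have vP : v *m mxC P = 0.
    have powM i : v *m mxC (M ^+ i) = w ^+ i *: v.
      elim: i => [|i IH]; first by rewrite !expr0 map_mx1 mulmx1 scale1r.
      by rewrite exprSr -mulmxE map_mxM mulmxA IH -scalemxAl vw scalerA exprSr.
    have PMi i : P *m M ^+ i = M ^+ i *m P.
      elim: i => [|i IH]; first by rewrite expr0 mulmx1 mul1mx.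
      by rewrite exprSr -mulmxE mulmxA IH -mulmxA PM mulmxA.
    apply: (scalerI (expf_neq0 n w0)).
    by rewrite scalemxAl -powM -mulmxA -map_mxM -PMi PMn map_mx0 mulmx0 scaler0.
  by rewrite XC vP mul0mx subr0 -PJ map_mxM mulmxA vP mul0mx scaler0 addr0.
have notnz w : w \in [:: z; z'] -> toC e * w \notin nz.
  move=> wz; apply: contra kN => ewnz; rewrite mem_cat -eC.
  have w0 : w != 0.
    by move: ewnz; rewrite mem_filter mulf_eq0 negb_or => /andP[/andP[]].
  move: wz; rewrite !inE => /orP[]/eqP we; rewrite -we; apply/orP; [left|right];
    by apply/mapP; exists (toC e * w); rewrite ?mulfK.
(* So [X] has at least two eigenvalues more than [nz] has elements, whereas [M] has at most one
   more. *)
have : (size [:: toC e * z, toC e * z' & nz]%R <= size (eigs X))%N.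
  apply: uniq_leq_size.
    rewrite /= inE negb_or (inj_eq (mulfI eC0)) zz' !notnz ?inE ?eqxx ?orbT//=.
    by rewrite filter_uniq ?eigs_uniq.
  move=> w; rewrite !inE => /or3P[/eqP->|/eqP->|]; [exact: Xe|exact: Xe|exact: Xnz].
move=> /leq_trans/(_ maxM)/leq_trans/(_ szM) /=.
by rewrite ltnn.
Qed.

(** The unique eigenvalue of [J] on the image of [P] equals its complex conjugate, [J] and [P] being
    real, and so is a real [a]. *)
Lemma max_eigs_scalar_nilpotent n (M P J : 'M[R]_n) :
  P *m P = P -> P *m M = M *m P -> P *m M ^+ n = 0 -> P != 0 ->
  P *m J = J -> J *m P = J ->
  (forall e, size (eigs (M - P *m M + e *: J)) <= size (eigs M))%N ->
  exists a, (J - a *: P) ^+ n = 0.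
Proof.
move=> PP PM PMn P0 PJ JP maxM; have [z Jz] := proj_eigenvalue_ex PP P0 JP.
have uniq := proj_eigenvalue_unique PP PM PMn PJ JP maxM.
have zR := uniq _ _ Jz (proj_eigenvalue_conj Jz).
exists (complex.Re z); apply: proj_eigenvalue_nilpotent => // w /uniq/(_ Jz) ->.
case: z zR {Jz} => x y [/eqP]; rewrite -addr_eq0 -mulr2n mulrn_eq0/= => /eqP y0.
by rewrite y0.
Qed.
Lemma mxtrace_nilpotent n (M : 'M[R]_n) k : M ^+ k = 0 -> \tr M = 0.
Proof.
move=> Mk; have [rs [rsE trE]] := mxtrace_pow_eigenvalues (mxC M).
apply: (fmorph_inj toC); rewrite -trace_map_mx rmorph0 -[mxC M]expr1 trE.
rewrite big_seq big1// => z; rewrite rsE expr1 => /eigenvalueP[v vz v0].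
have powM i : v *m mxC (M ^+ i) = z ^+ i *: v.
  elim: i => [|i IH]; first by rewrite !expr0 map_mx1 mulmx1 scale1r.
  by rewrite exprSr -mulmxE map_mxM mulmxA IH -scalemxAl vz scalerA exprSr.
have := powM k; rewrite Mk map_mx0 mulmx0 => /esym/eqP.
by rewrite scaler_eq0 expf_eq0 (negbTE v0) orbF => /andP[_ /eqP].
Qed.

End Eigenvalues.

(** * Zeros of one-parameter families of polynomials *)

Section CriticalSlices.
Context {R : realType}.
Implicit Types (l x e : R).

Lemma mean_value_two_sided (f df : R -> R) (a b : R) :
  (forall x, is_derive x 1 f (df x)) ->
  exists2 c, `|c - a| <= `|b - a| & f b - f a = df c * (b - a).
Proof.
move=> fdf.
have fc : continuous f by move=> x; apply/differentiable_continuous/derivable1_diffP.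
have [ab|/ltW ba] := leP a b.
  have [c /itvP cab ->] := MVT_segment ab (fun x _ => fdf x)
    (continuous_subspaceT fc).
  by exists c => //; rewrite !ger0_norm ?subr_ge0 ?lerD2r ?cab.
have [c /itvP cab eqf] := MVT_segment ba (fun x _ => fdf x)
  (continuous_subspaceT fc).
exists c; first by rewrite !ler0_norm ?subr_le0 ?lerN2 ?lerD2r ?cab.
by rewrite -opprB eqf -mulrN opprB.
Qed.

(** Only [p] is confined to [K], so that intermediate points of the mean value theorem can serve as
    [q] without being located. *)
Lemma compact_uniform_continuity (K : set (R * R)) (g : R * R -> R) e :
  compact K -> continuous g -> 0 < e ->
  \forall d \near 0^'+, forall p q, K p -> ball p d q -> `|g p - g q| < e.
Proof.
move=> /compact_near_coveringP cK gc e0.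
suff : \forall d \near 0^'+,
    K `<=` (fun p => forall q, ball p d q -> `|g p - g q| < e).
  by apply: filterS => d dK p q Kp; exact: dK.
apply: cK => p Kp.
have e20 : 0 < e / 2 by rewrite divr_gt0.
have /nbhs_ballP[r r0 rg] : \forall q \near p, `|g p - g q| < e / 2.
  by move/cvgrPdist_lt : (gc p); exact.
exists (ball p (r / 2), [set d | d < r / 2]).
  split; first by apply: nbhsx_ballx; rewrite divr_gt0.
  by apply: nbhs_right_lt; rewrite divr_gt0.
move=> [p' d] /= [pp' dr] q p'q.
rewrite (splitr e) -(subrKA (g p)) (le_lt_trans (ler_normD _ _))// ltrD//.
  rewrite distrC; apply: rg; apply: le_ball pp'.
  by move: r0 => /= r0; lra.
apply: rg; rewrite (splitr r); apply: ball_triangle pp' _.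
exact: le_ball (ltW dr) _ p'q.
Qed.

(** With [gl] and [gx] the partial derivatives of [g], these are critical values of the projection
    of the curve [g = 0] to the second coordinate. The bounds [n] and [k] cut the critical values
    with [gx] nonzero into countably many closed pieces, as Baire's theorem requires. *)
Definition critical_slices (g gl gx : R * R -> R) (n k : nat) : set R :=
  [set x | exists l, [/\ `|l| <= n%:R, `|x| <= n%:R, g (l, x) = 0,
    gl (l, x) = 0 & k.+1%:R^-1 <= `|gx (l, x)|]].

(** The set is the projection of a compact subset of the plane. *)
Lemma closed_critical_slices g gl gx n k :
  continuous g -> continuous gl -> continuous gx ->
  closed (critical_slices g gl gx n k).
Proof.
move=> gc glc gxc; pose I : set R := `[- n%:R, n%:R]%classic.
pose K := (I `*` I) `&` (g @^-1` [set 0] `&` gl @^-1` [set 0] `&`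
  (fun p => `|gx p|) @^-1` [set` `[k.+1%:R^-1, +oo[]).
have -> : critical_slices g gl gx n k = snd @` K.
  apply/seteqP; split => [x [l [ln xn g0 gl0 gxk]]|
      y [[l x] [[/= ln xn] [[/= g0 gl0] gxk]] <-]].
    exists (l, x) => //; rewrite /K/I /= !in_itv/= -!ler_norml.
    by rewrite ln xn gxk; do !split.
  rewrite /I /= !in_itv/= ?andbT in ln xn gxk.
  by exists l; rewrite !ler_norml ln xn.
apply: compact_closed; first exact: Rhausdorff.
apply: continuous_compact; first by apply: continuous_subspaceT => p; exact: cvg_snd.
apply: compact_closedI.
  by apply: compact_setX; exact: segment_compact.
have cl (f : R * R -> R) A : continuous f -> closed A -> closed (f @^-1` A).
  by move/continuous_closedP; exact.
have cl0 : closed [set (0 : R)] by exact: closed_eq.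
apply: closedI; [by apply: closedI; exact: cl|apply: cl].
  by move=> p; apply: continuous_comp; [exact: gxc|exact: norm_continuous].
by rewrite set_itvE; exact: closed_ge.
Qed.

(* The one-dimensional Sard argument: if [critical_slices] contained an
   interval, then two of [m] equidistant points of it would have witnesses [l]
   at distance [O(1/m)], whereas the values of [g] at these points force their
   distance to be [o(1/m)]. *)
Lemma dense_critical_slicesC g gl gx n k :
  continuous gl -> continuous gx ->
  (forall l x, is_derive l 1 (fun l => g (l, x)) (gl (l, x))) ->
  (forall l x, is_derive x 1 (fun x => g (l, x)) (gx (l, x))) ->
  dense (~` critical_slices g gl gx n k).
Proof.
move=> glc gxc gl' gx' O [x0 Ox0] oO; apply/set0P/negP => /eqP.
move=> /disjoints_subset; rewrite setCK => OS.
pose K := [set p : R * R | `|p.1| <= n.+1%:R /\ `|p.2| <= n.+1%:R].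
have cK : compact K.
  have -> : K = `[- n.+1%:R, n.+1%:R]%classic `*` `[- n.+1%:R, n.+1%:R]%classic.
    by apply/seteqP; split=> p /=; rewrite /K /= !in_itv/= -!ler_norml.
  by apply: compact_setX; exact: segment_compact.
have k0 : (0 : R) < k.+1%:R^-1 by rewrite invr_gt0.
have n0 : (0 : R) < n.+1%:R by [].
have k20 : (0 : R) < k.+1%:R^-1 / 2 by rewrite divr_gt0.
have [r [r0 rO rgx]] : exists r : R, [/\ 0 < r, ball x0 r `<=` O &
    forall p q, K p -> ball p r q -> `|gx p - gx q| < k.+1%:R^-1 / 2].
  have /nbhs_ballP[s s0 sO] : nbhs x0 O by apply: open_nbhs_nbhs.
  near (0 : R)^'+ => r; exists r; split => //.
    by apply: subset_trans sO; apply: le_ball; near: r; exact: nbhs_right_le.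
  by near: r; exact: compact_uniform_continuity.
have [h [h0 hr]] : exists h : R, 0 < h /\ h < r by exists (r / 2); lra.
(* With this [e], the final upper bound [e * (2 (n+1) / (m+1))] is a quarter of the lower bound
   [h / (2 (k+1) (m+1))]. *)
pose e := k.+1%:R^-1 * h / (16 * n.+1%:R).
have e0 : 0 < e by rewrite !(divr_gt0, mulr_gt0).
have [d [d0 dgl]] : exists d : R, 0 < d /\
    forall p q, K p -> ball p d q -> `|gl p - gl q| < e.
  near (0 : R)^'+ => d; exists d; split => //.
  by near: d; exact: compact_uniform_continuity.
have [m dm] : exists m : nat, 2 * n.+1%:R / m.+1%:R < Num.min d r.
  pose z := 2 * n.+1%:R / Num.min d r.
  exists (Num.truncn z); have := truncnS_gt z.
  have dr0 : 0 < Num.min d r by rewrite lt_min d0.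
  by rewrite /z !ltr_pdivrMr// [X in _ < X]mulrC.
have m0 : (0 : R) < m.+1%:R by [].
pose x_ i := x0 + h * (i%:R / m.+1%:R).
have xS i : (i <= m.+1)%N -> critical_slices g gl gx n k (x_ i).
  move=> im; apply: OS; apply: rO; rewrite /ball/= /x_ opprD addNKr normrN.
  rewrite ger0_norm ?mulr_ge0 ?divr_ge0 ?(ltW h0)//. rewrite (le_lt_trans _ hr)//.
  by rewrite ger_pMr// ler_pdivrMr// mul1r ler_nat.
have /choice[l_ lP] : forall i, exists l, (i <= m.+1)%N ->
    [/\ `|l| <= n%:R, `|x_ i| <= n%:R, g (l, x_ i) = 0,
      gl (l, x_ i) = 0 & k.+1%:R^-1 <= `|gx (l, x_ i)|].
  move=> i; have [im|_] := boolP (i <= m.+1)%N; last by exists 0.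
  by have [l] := xS i im; exists l.
have [i [j [ij jm lij]]] : exists i j, [/\ (i < j)%N, (j <= m.+1)%N &
    `|l_ i - l_ j| <= 2 * n.+1%:R / m.+1%:R].
  (* Pigeonhole: [m+2] witnesses fall into [m+1] boxes of length [2 (n+1) / (m+1)]. Taking [n+1]
     instead of [n] keeps this length positive for [n = 0] and the box index below [m+1]. *)
  pose b (i : 'I_m.+2) : 'I_m.+1 :=
    inord (Num.truncn ((l_ i + n%:R) / (2 * n.+1%:R) * m.+1%:R)).
  have [i [j [ij bij]]] : exists i j : 'I_m.+2, (i < j)%N /\ b i = b j.
    have /injectivePn[i [j ij bij]] : ~~ injectiveb b.
      by apply/negP => /injectiveP/leq_card; rewrite !card_ord ltnn.
    have [ltij|ltji|/val_inj eij] := ltngtP i j; first by exists i, j.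
      by exists j, i.
    by rewrite eij eqxx in ij.
  exists i, j; split=> //; first by rewrite -ltnS.
  have bE (i' : 'I_m.+2) : let y := (l_ i' + n%:R) / (2 * n.+1%:R) * m.+1%:R in
      ((b i')%:R <= y < (b i').+1%:R).
    move=> y; have [ln _ _ _ _] := lP i' (ltn_ord i' : (i' <= m.+1)%N).
    move: ln; rewrite ler_norml => /andP[ln1 ln2].
    have y0 : 0 <= y by rewrite !(mulr_ge0, divr_ge0)// -lerBlDr sub0r.
    have ym : y < m.+1%:R.
      rewrite /y gtr_pMl// ltr_pdivrMr; last by rewrite mulr_gt0.
      by rewrite mul1r -natr1; have : (0:R) <= n%:R by []; lra.
    rewrite /b inordK ?truncn_itv//.
    by rewrite -(ltr_nat R) (le_lt_trans _ ym)// truncn_le.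
  have /= /andP[i1 i2] := bE i; have /= /andP[j1 j2] := bE j.
  rewrite bij in i1 i2; rewrite -[(b j).+1%:R]natr1 in i2 j2.
  have : `|(l_ i + n%:R) / (2 * n.+1%:R) * m.+1%:R -
      (l_ j + n%:R) / (2 * n.+1%:R) * m.+1%:R| <= 1.
    rewrite ler_norml; move: i1 i2 j1 j2.
    move: (_ / _ * _) (_ / _ * _) (b j)%:R => u v w; lra.
  have -> : (l_ i + n%:R) / (2 * n.+1%:R) * m.+1%:R -
      (l_ j + n%:R) / (2 * n.+1%:R) * m.+1%:R =
      (l_ i - l_ j) * (m.+1%:R / (2 * n.+1%:R)) by field.
  rewrite normrM [X in _ * X]ger0_norm; last by rewrite divr_ge0// mulr_ge0.
  rewrite -ler_pdivlMr; last by rewrite divr_gt0// mulr_gt0.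
  by rewrite mul1r invf_div.
have [iln ixn gi gli gxi] := lP i (leq_trans (ltnW ij) jm).
have [jln jxn gj glj gxj] := lP j jm.
have nS (y : R) : `|y| <= n%:R -> `|y| <= n.+1%:R.
  by move=> /le_trans; apply; rewrite ler_nat.
move: dm; rewrite lt_min => /andP[dmd dmr].
(* Since [g] vanishes at both witnesses, the two increments equal [g (l_ j, x_ i)]: one runs from
   the witness [i] along [l], the other from the witness [j] along [x]. *)
have [c1 c1l gij1] := mean_value_two_sided (l_ i) (l_ j) (gl' ^~ (x_ i)).
have [c2 c2x gij2] := mean_value_two_sided (x_ j) (x_ i) (gx' (l_ j)).
have xij : x_ j - x_ i = h * ((j - i)%:R / m.+1%:R).
  by rewrite /x_ natrB ?(ltnW ij)//; field.
have xijr : `|x_ i - x_ j| <= h.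
  rewrite distrC xij ger0_norm ?mulr_ge0 ?divr_ge0 ?(ltW h0)//.
  rewrite ger_pMr// ler_pdivrMr// mul1r ler_nat.
  by rewrite (leq_trans (leq_subr _ _)).
have xijm : h / m.+1%:R <= `|x_ i - x_ j|.
  rewrite distrC xij ger0_norm ?mulr_ge0 ?divr_ge0 ?(ltW h0)//.
  rewrite ler_wpM2l ?(ltW h0)// ler_pdivlMr// mulVf ?gt_eqF//.
  by rewrite ler1n subn_gt0.
have gl1 : `|gl (c1, x_ i)| < e.
  rewrite -[gl _]subr0 -gli distrC; apply: dgl.
    by split; exact: nS.
  split=> /=; last exact: ballxx.
  by rewrite /ball/= distrC (le_lt_trans c1l)// distrC (le_lt_trans lij).
have gx2 : k.+1%:R^-1 / 2 < `|gx (l_ j, c2)|.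
  have : `|gx (l_ j, x_ j) - gx (l_ j, c2)| < k.+1%:R^-1 / 2.
    apply: rgx; first by split; exact: nS.
    split=> /=; first exact: ballxx.
    by rewrite /ball/= distrC (le_lt_trans c2x)// (le_lt_trans xijr).
  have := ler_normD (gx (l_ j, x_ j) - gx (l_ j, c2)) (gx (l_ j, c2)).
  rewrite subrK; move: gxj; move: `|_| `|_| `|_| (_^-1) => u v w t; lra.
have : `|gx (l_ j, c2)| * `|x_ i - x_ j| = `|gl (c1, x_ i)| * `|l_ j - l_ i|.
  rewrite -!normrM -gij1 -gij2 gi gj.
  by rewrite !subr0.
suff : `|gl (c1, x_ i)| * `|l_ j - l_ i| < `|gx (l_ j, c2)| * `|x_ i - x_ j|.
  by move=> /lt_eqF/eqP + /esym.
apply: (@le_lt_trans _ _ (e * (2 * n.+1%:R / m.+1%:R))).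
  by apply: ler_pM => //; [exact: ltW|rewrite distrC].
apply: (@lt_le_trans _ _ (k.+1%:R^-1 / 2 * (h / m.+1%:R))); last first.
  apply: ler_pM => //; [by rewrite divr_ge0 ?(ltW h0)|exact: ltW].
have -> : e * (2 * n.+1%:R / m.+1%:R) =
    4^-1 * (k.+1%:R^-1 / 2 * (h / m.+1%:R)).
  by rewrite /e; field; rewrite !nat1r !pnatr_eq0.
by rewrite gtr_pMl ?invf_lt1 ?ltr1n// mulr_gt0// divr_gt0.
Unshelve. all: by end_near. Qed.

(** * Continuously differentiable families of polynomials *)

Implicit Types (a b : R -> R) (p q : R -> {poly R}).

Definition C1 (a : R -> R) :=
  (forall l, derivable a l 1) /\ continuous (derive1 a).

Lemma C1_continuous a : C1 a -> continuous a.
Proof.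
by move=> [da _] l; apply/differentiable_continuous/derivable1_diffP.
Qed.

Lemma C1_cst (c : R) : C1 (cst c).
Proof.
split=> [l|]; first exact: derivable_cst.
rewrite (_ : derive1 _ = cst 0); first by move=> l; exact: cvg_cst.
by apply/funext => l; rewrite derive1_cst.
Qed.

Lemma C1D a b : C1 a -> C1 b -> C1 (a \+ b).
Proof.
move=> [da ca] [db cb]; split=> [l|]; first exact: derivableD.
rewrite (_ : derive1 _ = derive1 a \+ derive1 b).
  by move=> l; apply: cvgD; [exact: ca|exact: cb].
by apply/funext => l; rewrite /= !derive1E deriveD.
Qed.

Lemma C1M a b : C1 a -> C1 b -> C1 (a \* b).
Proof.
move=> C1a C1b; have [[da ca] [db cb]] := (C1a, C1b).
split=> [l|]; first exact: derivableM.
rewrite (_ : derive1 _ = (a \* derive1 b) \+ (b \* derive1 a)).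
  move=> l; apply: cvgD; apply: cvgM.
  - exact: C1_continuous.
  - exact: cb.
  - exact: C1_continuous.
  - exact: ca.
by apply/funext => l; rewrite /= !derive1E deriveM.
Qed.

Lemma C1_sum (I : Type) (s : seq I) (P : pred I) (a : I -> R -> R) :
  (forall i, C1 (a i)) -> C1 (fun l => \sum_(i <- s | P i) a i l).
Proof.
move=> C1a; elim: s => [|i s IH].
  by rewrite (_ : (fun _ => _) = cst 0); [exact: C1_cst|apply/funext => l; rewrite big_nil].
have [Pi|nPi] := boolP (P i).
  rewrite (_ : (fun _ => _) = a i \+ (fun l => \sum_(i <- s | P i) a i l)).
    exact: C1D.
  by apply/funext => l; rewrite big_cons Pi.
rewrite (_ : (fun _ => _) = (fun l => \sum_(i <- s | P i) a i l))//.
by apply/funext => l; rewrite big_cons (negbTE nPi).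
Qed.

(** The uniform degree bound makes evaluation a sum with a fixed number of terms, hence jointly
    continuous in the parameter and the point. *)
Definition C1poly (p : R -> {poly R}) :=
  (exists D, forall l, (size (p l) <= D)%N) /\
  forall i, C1 (fun l => (p l)`_i).

Lemma C1poly_cst (q : {poly R}) : C1poly (fun=> q).
Proof. by split=> [|i]; [exists (size q)|exact: C1_cst]. Qed.

Lemma C1polyC a : C1 a -> C1poly (fun l => (a l)%:P).
Proof.
move=> C1a; split=> [|i]; first by exists 1 => l; rewrite size_polyC leq_b1.
under eq_fun do rewrite coefC.
by case: eqP => _; [exact: C1a|exact: C1_cst].
Qed.

Lemma C1polyD p q : C1poly p -> C1poly q -> C1poly (fun l => p l + q l).
Proof.
move=> [[D pD] C1p] [[E qE] C1q]; split=> [|i].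
  exists (maxn D E) => l; rewrite (leq_trans (size_polyD _ _))//.
  by rewrite geq_max !leq_max pD qE orbT.
by under eq_fun do rewrite coefD; exact: C1D.
Qed.

Lemma C1polyM p q : C1poly p -> C1poly q -> C1poly (fun l => p l * q l).
Proof.
move=> [[D pD] C1p] [[E qE] C1q]; split=> [|i].
  exists (D + E)%N => l; rewrite (leq_trans (size_polyMleq _ _))//.
  by rewrite (leq_trans (leq_pred _))// leq_add.
under eq_fun do rewrite coefM.
by apply: C1_sum => j; exact: C1M.
Qed.

Lemma C1poly_sum (I : Type) (s : seq I) (p : I -> R -> {poly R}) :
  (forall i, C1poly (p i)) -> C1poly (fun l => \sum_(i <- s) p i l).
Proof.
move=> C1p; elim: s => [|i s IH]; under eq_fun do rewrite ?big_nil ?big_cons.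
  exact: C1poly_cst.
exact: C1polyD.
Qed.

Lemma C1poly_prod (I : Type) (s : seq I) (p : I -> R -> {poly R}) :
  (forall i, C1poly (p i)) -> C1poly (fun l => \prod_(i <- s) p i l).
Proof.
move=> C1p; elim: s => [|i s IH]; under eq_fun do rewrite ?big_nil ?big_cons.
  exact: C1poly_cst.
exact: C1polyM.
Qed.

Lemma C1poly_det n (M : R -> 'M[{poly R}]_n) :
  (forall i j, C1poly (fun l => M l i j)) -> C1poly (fun l => \det (M l)).
Proof.
move=> C1m; rewrite /determinant; apply: C1poly_sum => s.
by apply: C1polyM; [exact: C1poly_cst|apply: C1poly_prod].
Qed.

Lemma C1poly_derivn p j : C1poly p -> C1poly (fun l => (p l)^`(j)).
Proof.
move=> C1p; elim: j => [//|j [[D pD] C1pj]].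
under eq_fun do rewrite derivnS.
split=> [|i].
  by exists D => l; rewrite (leq_trans (size_poly _ _))// (leq_trans (leq_pred _)).
under eq_fun do rewrite coef_deriv -mulr_natl.
by apply: C1M => //; exact: C1_cst.
Qed.

Lemma continuous_horner2 (p : R -> {poly R}) D :
  (forall l, (size (p l) <= D)%N) ->
  (forall i, continuous (fun l => (p l)`_i)) ->
  continuous (fun q : R * R => (p q.1).[q.2]).
Proof.
move=> pD pc; under eq_fun do rewrite (horner_coef_wide _ (pD _)).
apply: continuous_big => [|i _ q]; first exact: add_continuous.
apply: cvgM.
  apply: (@cvg_comp _ _ _ fst (fun l => (p l)`_i) _ (nbhs q.1)); last exact: pc.
  exact: cvg_fst.
apply: (@cvg_comp _ _ _ snd (fun x : R => x ^+ i) _ (nbhs q.2)).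
  exact: cvg_snd.
exact: exprn_continuous.
Qed.

(** At another zero of [f] the difference quotient based at [l] vanishes, while near [l] it is close
    to [d != 0]. *)
Lemma isolated_simple_zero (f : R -> R) l (d : R) :
  is_derive l 1 f d -> f l = 0 -> d != 0 -> isolated [set l | f l = 0] l.
Proof.
move=> [fl <-] fl0 d0; split; first exact/mem_set.
have : (fun h => h^-1 *: ((f \o shift l) (h *: 1) - f l)) @ 0^' --> 'D_1 f l by [].
rewrite fl0 => /cvgrPdist_lt/(_ `|'D_1 f l|); rewrite normr_gt0 => /(_ d0).
move=> /nbhs_ballP[r r0 rf]; exists (ball l r); first exact: nbhsx_ballx.
apply/seteqP; split=> [m [lm fm]|_ ->]; last by split=> //; exact: ballxx.
apply/eqP; rewrite -subr_eq0; apply/negPn/negP => ml0.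
have /= := rf (m - l).
rewrite /ball/= sub0r opprB => /(_ lm ml0).
by rewrite [_ *: 1]mulr1 subrK fm subrr scaler0 subr0 ltxx.
Qed.

(** At a zero [(l, x)], take the least order [j+1] at which the derivative in [x] is nonzero. If [x]
    is outside the critical slices of the [j]-th derivative [q j], then [l] is a simple, hence
    isolated, zero of [q j] at this [x]. Isolated points are countable for each [j], and Baire's
    theorem makes such [x] dense. *)
Lemma countable_zero_slices p : C1poly p -> (forall l, p l != 0) ->
  dense [set x | countable [set l | (p l).[x] = 0]].
Proof.
move=> C1p p0; pose q j l := (p l)^`(j).
have C1q j : C1poly (q j) by exact: C1poly_derivn.
have [D pD] : exists D, forall j l, (size (q j l) <= D j)%N.
  by have /choice[D] : forall j, exists D, forall l, (size (q j l) <= D)%N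
    by [move=> j; have [] := C1q j]; exists D.
pose dq j l := \poly_(i < D j) derive1 (fun l => (q j l)`_i) l.
(* Enumeration of all triples [(j, n, k)]; an [i] that codes no triple contributes the empty set. *)
pose N i : set R := if unpickle i is Some (j, n, k) then
  critical_slices (fun r => (q j r.1).[r.2]) (fun r => (dq j r.1).[r.2])
    (fun r => (q j.+1 r.1).[r.2]) n k else set0.
have q2 j : continuous (fun r : R * R => (q j r.1).[r.2]).
  apply: (continuous_horner2 (pD j)) => i; apply: C1_continuous.
  by have [] := C1q j.
have dq2 j : continuous (fun r : R * R => (dq j r.1).[r.2]).
  apply: (@continuous_horner2 _ (D j)) => [l|i]; first exact: size_poly.
  under eq_fun do rewrite coef_poly.
  case: (i < D j)%N; last exact: cst_continuous.
  by have [_ /(_ i)[]] := C1q j.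
have q_l j l x : is_derive l 1 (fun l => (q j l).[x]) (dq j l).[x].
  under eq_fun do rewrite (horner_coef_wide _ (pD _ _)).
  rewrite horner_poly; under eq_bigr do rewrite mulrC.
  rewrite (_ : (fun _ => _) =
    \sum_(i < D j) (x ^+ i *: (fun l => (q j l)`_i))); last first.
    by apply/funext => l'; rewrite fct_sumE; apply: eq_bigr => i _; rewrite mulrC.
  apply: is_derive_sum => i; apply: is_deriveZ.
  have [_ /(_ i)[/(_ l) dqi _]] := C1q j.
  by split=> //; rewrite derive1E.
have q_x j l x : is_derive x 1 (fun x => (q j l).[x]) (q j.+1 l).[x].
  split; first exact: derivable_horner.
  by rewrite -derive1E -derivE /q derivnS.
have dN i : open (~` N i) /\ dense (~` N i).
  rewrite /N; case: unpickle => [[[j n] k]|].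
    split; first by apply/closed_openC/closed_critical_slices.
    by apply: dense_critical_slicesC.
  by rewrite setC0; split; [exact: openT|move=> O [x Ox] _; exists x].
suff sub : \bigcap_i ~` N i `<=` [set x | countable [set l | (p l).[x] = 0]].
  by move=> O O0 oO; have [x [Ox Nx]] := Baire dN O0 oO; exists x; split=> //; exact: sub.
move=> x Nx.
apply: (@sub_countable _ _ _ (\bigcup_j isolated [set l | (q j l).[x] = 0])).
  apply: subset_card_le => l /= pl0.
  (* The derivative whose order is the degree of [p l] is a nonzero constant. *)
  have ex : exists j, (q j l).[x] != 0.
    have [s sz] : exists s, size (p l) = s.+1.
      by exists (size (p l)).-1; rewrite prednK// size_poly_gt0.
    exists s; rewrite /q (_ : _^`(s) = ((p l)`_s *+ s ^_ s)%:P).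
      rewrite hornerC mulrn_eq0 negb_or -lt0n ffact_gt0 leqnn/=.
      by move: (p0 l); rewrite -lead_coef_eq0 lead_coefE sz.
    apply/polyP => -[|i]; rewrite coef_derivn coefC ?addn0//=.
    by rewrite nth_default ?mul0rn// sz addnS ltnS leq_addr.
  case: (ex_minnP ex) => [[|j]] qj minj; first by rewrite /q pl0 eqxx in qj.
  have qj0 : (q j l).[x] = 0.
    by apply/eqP/negPn/negP => /minj; rewrite ltnn.
  exists j => //; apply: (isolated_simple_zero (q_l j l x)) => //.
  apply/eqP => dq0.
  (* The bounds [n] and [k] are taken large enough for [(l, x)] to exhibit [x] as a point of a
     critical slice. *)
  pose n := maxn (Num.truncn `|l|).+1 (Num.truncn `|x|).+1.
  have := truncnS_gt `|(q j.+1 l).[x]|^-1; set k := Num.truncn _ => kq.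
  apply: (Nx (pickle (j, n, k)) I); rewrite /N pickleK.
  exists l; split=> //.
  - by rewrite (le_trans (ltW (truncnS_gt _)))// ler_nat leq_maxl.
  - by rewrite (le_trans (ltW (truncnS_gt _)))// ler_nat leq_maxr.
  - by rewrite -[leRHS]invrK lef_pV2 ?posrE ?invr_gt0 ?normr_gt0// ltW.
by apply: bigcup_countable => // j _; exact: countable_isolated.
Qed.

End CriticalSlices.

(** * Perturbations avoiding common zeros of the Hankel determinant and the determinant *)

Section GenericPerturbation.
Context {R : realType}.

(** A countable set has Lebesgue measure zero and so contains no ball. *)
Lemma dense_countableC (A : set R) : countable A -> dense (~` A).
Proof.
move=> cA O [x Ox] oO; apply/set0P/negP => /eqP/disjoints_subset.
rewrite setCK => OA; have [r /= r0 rO] : nbhs_ball x O.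
  by apply/nbhs_ballP; exact: open_nbhs_nbhs.
have : lebesgue_measure (ball x r) = 0%E.
  apply: countable_lebesgue_measure0; apply: sub_countable cA.
  by apply: subset_card_le; exact: subset_trans OA.
rewrite lebesgue_measure_ball ?(ltW r0)// => /eqP.
by rewrite eqe mulrn_eq0/= gt_eqF.
Qed.

Definition hankel_poly m n (M N : 'M[R]_n) : {poly R} :=
  \det (\matrix_(i < m, j < m)
    \tr ((map_mx polyC M + 'X *: map_mx polyC N) ^+ (i + j))).

Lemma horner_hankel_poly m n (M N : 'M[R]_n) x :
  (hankel_poly m M N).[x] = hankel m (M + x *: N).
Proof.
rewrite -/(horner_eval x _) /hankel_poly -det_map_mx /hankel; congr (\det _).
apply/matrixP => i j; rewrite !mxE -trace_map_mx rmorphXn/=.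
congr (\tr (_ ^+ _)); apply/matrixP => k l.
by rewrite !mxE /horner_eval hornerD hornerM hornerX !hornerC.
Qed.

Lemma C1poly_mx_exp n (M : R -> 'M[{poly R}]_n) k :
  (forall i j, C1poly (fun l => M l i j)) ->
  forall i j, C1poly (fun l => (M l ^+ k) i j).
Proof.
move=> C1M; elim: k => [|k IH] i j.
  by under eq_fun do rewrite expr0; exact: C1poly_cst.
under eq_fun do rewrite exprS -mulmxE mxE.
by apply: C1poly_sum => h; exact: C1polyM.
Qed.

Lemma C1poly_hankel_poly m n (M : 'M[R]_n) (L : R -> 'M[R]_n) :
  (forall i j, C1 (fun l => L l i j)) ->
  C1poly (fun l => hankel_poly m M (L l)).
Proof.
move=> C1L; apply: C1poly_det => i j; under eq_fun do rewrite mxE.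
apply: C1poly_sum => k; apply: C1poly_mx_exp => {i j k} i j.
under eq_fun do rewrite !mxE; apply: C1polyD; first exact: C1poly_cst.
by apply: C1polyM; [exact: C1poly_cst|exact: C1polyC].
Qed.

Lemma countable_det_shift n (M : 'M[R]_n) :
  countable [set s : R | \det (M + s%:M) = 0].
Proof.
apply: (@sub_countable _ _ _ [set` [seq complex.Re z | z <- eigs (- M)]]).
  apply: subset_card_le => s /= ds; apply/mapP; exists (real_complex R s) => //.
  apply/eigsP; have /det0P[v v0 vs] : \det (s%:M - - M) == 0.
    by rewrite opprK addrC ds.
  exists (map_mx (real_complex R) v); last by rewrite map_mx_eq0.
  move/eqP: vs; rewrite mulmxBr mul_mx_scalar subr_eq0 => /eqP vs.
  by rewrite -map_mxM -vs map_mxZ.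
exact/finite_set_countable/finite_seq.
Qed.

(* [c] is the inverse of a large parameter [x] for which the polynomials
   [hankel_poly m M0 (L l)] vanish at [x] for countably many [l] only; then [s]
   avoids the eigenvalues at these [l]. *)
Lemma generic_affine_perturbation m n (M0 : 'M[R]_n) (L : R -> 'M[R]_n) e :
  size (eigs M0) = m ->
  (forall i j, C1 (fun l => L l i j)) ->
  (forall l x, size (eigs (M0 + x *: L l)) <= m)%N -> 0 < e ->
  exists c s, [/\ `|c| < e, `|s| < e & forall l,
    let M := L l + c *: M0 + s%:M in hankel m M != 0 \/ \det M != 0].
Proof.
move=> szM0 C1L maxm e0.
(* The value at [0] is [hankel m M0], which is nonzero because [M0] has [m] eigenvalues. *)
have p0 l : hankel_poly m M0 (L l) != 0.
  apply/eqP => p0; have := @hankel_neq0 _ m _ M0.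
  rewrite szM0 leqnn eqxx => /(_ isT).
  rewrite -[M0 in hankel _ M0]addr0 -[X in M0 + X](scale0r (L l)).
  by rewrite -horner_hankel_poly p0 horner0 eqxx.
have [x [/= xe Zx]] : [set x | e^-1 < x] `&` [set x | countable
    [set l | (hankel_poly m M0 (L l)).[x] = 0]] !=set0.
  apply: (countable_zero_slices (C1poly_hankel_poly m M0 C1L) p0).
    by exists (e^-1 + 1); rewrite /= ltrDl.
  exact: open_gt.
have x0 : 0 < x by rewrite (lt_trans _ xe)// invr_gt0.
pose S := \bigcup_(l in [set l | (hankel_poly m M0 (L l)).[x] = 0])
  [set s : R | \det (L l + x^-1 *: M0 + s%:M) = 0].
have cS : countable S.
  by apply: bigcup_countable => // l _; exact: countable_det_shift.
have [s [/= se Ss]] : [set s : R | `|s| < e] `&` ~` S !=set0.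
  apply: dense_countableC => //; first by exists 0; rewrite /= normr0.
  rewrite (_ : mkset _ = ball 0 e); first exact: ball_open.
  by apply/seteqP; split=> s /=; rewrite /ball/= sub0r normrN.
exists x^-1, s; split=> //.
  by rewrite gtr0_norm ?invr_gt0// -[e]invrK ltf_pV2 ?posrE ?invr_gt0.
move=> l /=; have [Zl|Zl] := eqVneq ((hankel_poly m M0 (L l)).[x]) 0.
  by right; apply/eqP => dM; apply: Ss; exists l.
(* Up to the factor [x^-1] and the shift by [s], which preserve the number of eigenvalues, the
   matrix is [M0 + x *: L l], whose Hankel determinant is nonzero. *)
left; have sz : size (eigs (L l + x^-1 *: M0 + s%:M)) = m.
  have -> : L l + x^-1 *: M0 = x^-1 *: (M0 + x *: L l).
    by rewrite scalerDr scalerA mulVf ?gt_eqF// scale1r addrC.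
  have x1 : x^-1 != 0 by rewrite invr_eq0 gt_eqF.
  rewrite (eigs_affine _ s x1).
  apply/eqP.
  by rewrite -(hankel_neq0 (maxm l x)) -horner_hankel_poly.
by rewrite (@hankel_neq0 _ m) sz.
Qed.

End GenericPerturbation.

(** * Absolutely indecomposable representations *)

Section EndomorphismMatrices.
Context {R : realType} {U : vectType R}.
Implicit Types (f g : 'End(U)) (u v : U).

Lemma v2r_lfun f v : v2r (f v) = v2r v *m f2mx f.
Proof. by rewrite unlock /= r2vK. Qed.

Lemma f2mx_inj : injective (f2mx : 'End(U) -> _).
Proof. exact: val_inj. Qed.

Lemma f2mx_eqP f M : (forall v, v2r (f v) = v2r v *m M) -> f2mx f = M.
Proof.
by move=> fM; apply/row_matrixP => i; rewrite !rowE -[delta_mx _ _]r2vK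
  -v2r_lfun fM.
Qed.

Lemma f2mx_comp f g : f2mx (f \o g)%VF = f2mx g *m f2mx f.
Proof.
by apply: f2mx_eqP => v; rewrite comp_lfunE !v2r_lfun mulmxA.
Qed.

Lemma f2mx1 : f2mx (\1%VF : 'End(U)) = 1%:M.
Proof. by apply: f2mx_eqP => v; rewrite id_lfunE mulmx1. Qed.

Lemma f2mxD f g : f2mx (f + g) = f2mx f + f2mx g.
Proof.
by apply: f2mx_eqP => v; rewrite add_lfunE linearD/= !v2r_lfun mulmxDr.
Qed.

Lemma f2mxZ (a : R) f : f2mx (a *: f) = a *: f2mx f.
Proof.
by apply: f2mx_eqP => v; rewrite scale_lfunE linearZ/= v2r_lfun scalemxAr.
Qed.

Lemma f2mxB f g : f2mx (f - g) = f2mx f - f2mx g.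
Proof. by rewrite -scaleN1r f2mxD f2mxZ scaleN1r. Qed.

Lemma f2mx_pow f k : f2mx (lfun_pow f k) = f2mx f ^+ k.
Proof.
elim: k => [|k IH]; first by rewrite f2mx1.
by rewrite exprSr -mulmxE -IH -f2mx_comp.
Qed.

Lemma lfun_powS f k v : lfun_pow f k.+1 v = f (lfun_pow f k v).
Proof. exact: comp_lfunE. Qed.

Lemma det_f2mx_bijective f : \det (f2mx f) != 0 -> bijective f.
Proof.
move=> df; have fu : f2mx f \in unitmx by rewrite unitmxE unitfE.
exists (Hom (invmx (f2mx f)) : 'End(U)) => v; apply: v2r_inj.
  by rewrite !v2r_lfun mulmxK.
by rewrite !v2r_lfun mulmxKV.
Qed.

Lemma det_f2mx0 f : \det (f2mx f) = 0 -> exists2 v, v != 0 & f v = 0.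
Proof.
move=> /eqP/det0P[r r0 rf]; exists (r2v r).
  by apply: contra_neq r0 => r0; rewrite -[r]r2vK r0 linear0.
by apply: v2r_inj; rewrite v2r_lfun r2vK rf linear0.
Qed.

End EndomorphismMatrices.

(** * Representations whose equivariant endomorphisms are scalar plus nilpotent *)

Section ScalarPlusNilpotent.
Context {R : realType} {S : monoidType} {U : vectType R}.
Variable A : S -> 'End(U).
Implicit Types (f g : 'End(U)) (u v : U) (a b : R) (W : {vspace U}).
Hypothesis U0 : {:U}%VS <> 0%VS.
Hypothesis scalar_nilpotent : forall f, equivariant_end A f ->
  exists a k, lfun_pow (f - a *: \1%VF) k = 0.

Let nontrivial : exists v : U, v != 0.
Proof.
exists (vpick {:U}%VS); rewrite vpick0; exact/eqP.
Qed.

Lemma equivariant_end1 : equivariant_end A \1%VF.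
Proof. by move=> s; rewrite comp_lfun1l comp_lfun1r. Qed.

Lemma equivariant_endD f g :
  equivariant_end A f -> equivariant_end A g -> equivariant_end A (f + g).
Proof. by move=> Ef Eg s; rewrite comp_lfunDl comp_lfunDr Ef Eg. Qed.

Lemma equivariant_endZ a f :
  equivariant_end A f -> equivariant_end A (a *: f).
Proof. by move=> Ef s; rewrite -comp_lfunZl -comp_lfunZr Ef. Qed.

Lemma equivariant_endB f g :
  equivariant_end A f -> equivariant_end A g -> equivariant_end A (f - g).
Proof.
by move=> Ef Eg; rewrite -scaleN1r; apply/equivariant_endD/equivariant_endZ.
Qed.

Lemma equivariant_end_comp f g :
  equivariant_end A f -> equivariant_end A g -> equivariant_end A (f \o g)%VF.
Proof. by move=> Ef Eg s; rewrite -comp_lfunA Eg comp_lfunA Ef comp_lfunA. Qed.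

Lemma nilpotent_singular f k : lfun_pow f k = 0 -> exists2 v, v != 0 & f v = 0.
Proof.
have [v v0] := nontrivial; move=> /lfunP/(_ v); rewrite zero_lfunE.
elim: k v v0 => [|k IH] v v0; first by rewrite id_lfunE => /eqP; rewrite (negbTE v0).
rewrite lfun_powS; have [/(IH v v0)|fv] := eqVneq (lfun_pow f k v) 0; first by [].
  move=> fkv;
by exists (lfun_pow f k v).
Qed.

Lemma nilpotent_eigenvector f k v a :
  lfun_pow f k = 0 -> v != 0 -> f v = a *: v -> a = 0.
Proof.
move=> fk v0 fv; have : lfun_pow f k v = a ^+ k *: v.
  elim: k {fk} => [|k IH]; first by rewrite id_lfunE scale1r.
  by rewrite lfun_powS IH linearZ/= fv scalerA exprSr.
rewrite fk zero_lfunE => /esym/eqP.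
by rewrite scaler_eq0 expf_eq0 (negbTE v0) orbF => /andP[_ /eqP].
Qed.

Let d : R := (dim U)%:R.

Let d0 : d != 0.
Proof.
rewrite pnatr_eq0 -dimvf dimv_eq0; exact/eqP.
Qed.

(** Normalized trace: nilpotents have trace zero, so it recovers [a] from [a] plus a nilpotent. It
    is linear by construction, which leaves multiplicativity to be shown. *)
Definition scalar_part f := \tr (f2mx f) / d.

Lemma scalar_part1 : scalar_part \1%VF = 1.
Proof. by rewrite /scalar_part f2mx1 mxtrace1 divff. Qed.

Lemma scalar_partD f g : scalar_part (f + g) = scalar_part f + scalar_part g.
Proof. by rewrite /scalar_part f2mxD mxtraceD mulrDl. Qed.

Lemma scalar_partZ a f : scalar_part (a *: f) = a * scalar_part f.
Proof. by rewrite /scalar_part f2mxZ mxtraceZ mulrA. Qed.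

Lemma scalar_partB f g : scalar_part (f - g) = scalar_part f - scalar_part g.
Proof. by rewrite -scaleN1r scalar_partD scalar_partZ mulN1r. Qed.

Lemma scalar_part_nilpotent f k : lfun_pow f k = 0 -> scalar_part f = 0.
Proof.
move=> fk; rewrite /scalar_part (@mxtrace_nilpotent _ _ _ k) ?mul0r//.
by rewrite -f2mx_pow fk -(scale0r (\1%VF)) f2mxZ scale0r.
Qed.

Lemma sub_scalar_part_nilpotent f : equivariant_end A f ->
  exists k, lfun_pow (f - scalar_part f *: \1%VF) k = 0.
Proof.
move=> /scalar_nilpotent[a [k fk]]; exists k.
have := scalar_part_nilpotent fk.
by rewrite scalar_partB scalar_partZ scalar_part1 mulr1 => /subr0_eq ->.
Qed.

Lemma scalar_part_eq0 f : equivariant_end A f -> scalar_part f = 0 ->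
  nilpotent_end A f.
Proof.
move=> Ef f0; split=> //; have [k] := sub_scalar_part_nilpotent Ef.
by rewrite f0 scale0r subr0; exists k.
Qed.

Lemma scalar_part_eigenvector f v a : equivariant_end A f ->
  v != 0 -> f v = a *: v -> scalar_part f = a.
Proof.
move=> Ef v0 fv; have [k /nilpotent_eigenvector] := sub_scalar_part_nilpotent Ef.
move=> /(_ v (a - scalar_part f) v0) H; apply/esym/subr0_eq/H.
by rewrite add_lfunE opp_lfunE scale_lfunE id_lfunE fv scalerBl.
Qed.

(** With [a] and [b] the scalar parts, [g - b] is nilpotent and kills some [v != 0]. Hence
    [(f - a) \o (g - b)] has the eigenvalue [0], which must be its scalar part; the formula follows
    by expansion. *)
Lemma scalar_partM f g : equivariant_end A f -> equivariant_end A g ->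
  scalar_part (f \o g)%VF = scalar_part f * scalar_part g.
Proof.
move=> Ef Eg; pose a := scalar_part f; pose b := scalar_part g.
have [k /nilpotent_singular[v v0 gv]] := sub_scalar_part_nilpotent Eg.
have Ea h c : equivariant_end A h -> equivariant_end A (h - c *: \1%VF).
  by move=> Eh; apply: equivariant_endB => //; apply/equivariant_endZ/equivariant_end1.
have nm0 : scalar_part ((f - a *: \1) \o (g - b *: \1))%VF = 0.
  apply: (scalar_part_eigenvector _ v0); last by rewrite comp_lfunE gv linear0 scale0r.
  by apply: equivariant_end_comp; exact: Ea.
have : (f \o g = ((f - a *: \1) \o (g - b *: \1)) + a *: g + b *: f
    - (a * b) *: \1)%VF.
  apply/lfunP => w; rewrite !(comp_lfunE, add_lfunE, opp_lfunE, scale_lfunE, id_lfunE).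
  by rewrite (linearB f) (linearZ_LR f) scalerBr scalerA opprB
    addrA subrK (addrAC _ ((a * b) *: w)) subrK addrK.
move=> ->; rewrite scalar_partB !scalar_partD !scalar_partZ nm0 scalar_part1.
by rewrite add0r mulr1 [b * _]mulrC addrK.
Qed.

(** The projection of a decomposition would be equivariant with both eigenvalues [1] and [0], but an
    equivariant endomorphism has only its scalar part as a real eigenvalue. *)
Lemma scalar_nilpotent_indecomposable : indecomposable A.
Proof.
split=> // -[W1 [W2 [AW1 AW2 W1f W2f [W12 W120]]]].
pose e : 'End(U) := daddv_pi W1 W2.
have e1 v : v \in W1 -> e v = v by exact: daddv_pi_id.
have e2 v : v \in W2 -> e v = 0.
  move=> vW2; have := daddv_pi_add W120 (_ : v \in W1 + W2)%VS.
  rewrite W12 memvf => /(_ isT).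
  rewrite (@daddv_pi_id _ _ W2 W1 v) ?(capvC W2)// => /(canRL (addrK _)).
  by rewrite subrr.
have AWE (W : {vspace U}) : subrepresentation A W ->
    forall s v, v \in W -> A s v \in W.
  by move=> AW s v vW; apply: (subvP (AW s)); rewrite memv_img.
have Ee : equivariant_end A e.
  move=> s; apply/lfunP => v; rewrite !comp_lfunE.
  have /memv_addP[v1 v1W [v2 v2W ->]] : v \in (W1 + W2)%VS by rewrite W12 memvf.
  rewrite !linearD/= (e1 v1)// (e2 v2)// (e1 (A s v1)) ?(AWE W1)//.
  by rewrite (e2 (A s v2)) ?(AWE W2)// linear0.
have [v1 v1W v10] : exists2 v, v \in W1 & v != 0.
  exists (vpick W1); first exact: memv_pick.
  by rewrite vpick0; apply/eqP => W10; apply: W2f; rewrite -W12 W10 add0v.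
have [v2 v2W v20] : exists2 v, v \in W2 & v != 0.
  exists (vpick W2); first exact: memv_pick.
  by rewrite vpick0; apply/eqP => W20; apply: W1f; rewrite -W12 W20 addv0.
have := scalar_part_eigenvector Ee v10 (_ : e v1 = 1 *: v1).
rewrite e1// scale1r => /(_ erefl) s1.
have := scalar_part_eigenvector Ee v20 (_ : e v2 = 0 *: v2).
rewrite e2// scale0r => /(_ erefl)/eqP.
by rewrite s1 oner_eq0.
Qed.

Lemma nilpotent_cosetE f : equivariant_end A f ->
  nilpotent_coset A f = [set g | equivariant_end A g /\ scalar_part g = scalar_part f].
Proof.
move=> Ef; apply/seteqP; split=> g /= [Eg fg]; split=> //.
  case: fg => _ [k /scalar_part_nilpotent].
  by rewrite scalar_partB => /subr0_eq.
apply: scalar_part_eq0; first exact: equivariant_endB.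
by rewrite scalar_partB fg subrr.
Qed.

Lemma scalar_nilpotent_iso_R : end_mod_nilpotent_iso_R A.
Proof.
(* The common value of [scalar_part] on a coset; the default [0] concerns the empty set, which is
   not a coset. *)
pose psi (X : set 'End(U)) : R := xget 0 [set a | exists2 g, X g & a = scalar_part g].
have psiE f : equivariant_end A f -> psi (nilpotent_coset A f) = scalar_part f.
  move=> Ef; rewrite /psi nilpotent_cosetE//; apply: xget_unique => [|a /=].
    by exists f.
  by move=> [g [_ ->]].
exists psi; split.
- split.
  + by [].
  + move=> X Y /set_mem[f Ef <-] /set_mem[g Eg <-].
    by rewrite !psiE// !nilpotent_cosetE// => ->.
  + move=> a _; have Ea : equivariant_end A (a *: \1%VF).
      exact/equivariant_endZ/equivariant_end1.
    exists (nilpotent_coset A (a *: \1%VF)); first by exists (a *: \1%VF).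
    by rewrite psiE// scalar_partZ scalar_part1 mulr1.
- by rewrite psiE ?scalar_part1//; exact: equivariant_end1.
- move=> f g /set_mem Ef /set_mem Eg.
  by rewrite !psiE// ?scalar_partD//; exact: equivariant_endD.
- move=> f g /set_mem Ef /set_mem Eg.
  by rewrite !psiE// ?scalar_partM//; exact: equivariant_end_comp.
- move=> a f /set_mem Ef.
  by rewrite !psiE// ?scalar_partZ//; exact: equivariant_endZ.
Qed.

Lemma scalar_nilpotent_absolutely_indecomposable : absolutely_indecomposable A.
Proof.
split; [exact: scalar_nilpotent_indecomposable|exact: scalar_nilpotent_iso_R].
Qed.

End ScalarPlusNilpotent.

(** * The generalized kernel of an endomorphism with the maximal number of eigenvalues *)

Section GeneralizedKernel.
Context {R : realType} {S : monoidType} {U : vectType R}.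
Variable A : S -> 'End(U).
Implicit Types (f g : 'End(U)) (u v : U).

Lemma equivariant_f2mx f s : equivariant_end A f ->
  f2mx (A s) *m f2mx f = f2mx f *m f2mx (A s).
Proof. by move=> /(_ s) fA; rewrite -!f2mx_comp fA. Qed.

Lemma equivariant_end_pow f k :
  equivariant_end A f -> equivariant_end A (lfun_pow f k).
Proof.
move=> Ef; elim: k => [|k IH]; first exact: equivariant_end1.
exact: equivariant_end_comp.
Qed.

Lemma subrepresentation_generalized_kernel f :
  equivariant_end A f -> subrepresentation A (generalized_kernel f).
Proof.
move=> Ef s; apply/subvP => _ /memv_imgP[v vW ->].
move: vW; rewrite !memv_ker => /eqP fv.
have /lfunP/(_ v) := equivariant_end_pow (\dim {:U}) Ef s.
by rewrite !comp_lfunE fv linear0 => ->.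
Qed.

(** An endomorphism [g] of the generalized kernel extends to [J] on the whole space through the
    projection [p]. As [p] commutes with all that commutes with [f], both [J] and the modification
    of [f] by multiples of [J] are equivariant, so that maximality bounds their eigenvalues. *)
Lemma max_eigs_generalized_kernel f : equivariant_end A f ->
  (forall g, equivariant_end A g ->
    (size (eigs (f2mx g)) <= size (eigs (f2mx f)))%N) ->
  ~ bijective f ->
  absolutely_indecomposable (restriction A (generalized_kernel f)).
Proof.
move=> Ef maxf fb; set W := generalized_kernel f.
have AW : subrepresentation A W by exact: subrepresentation_generalized_kernel.
have [P [PP PMn Pcomm PW]] := generalized_kernel_projection (f2mx f).
pose p : 'End(U) := Hom P.
have memW v : v \in W = (v2r v *m f2mx f ^+ dim U == 0).
  rewrite /W /generalized_kernel memv_ker -(inj_eq (@v2r_inj _ _)) v2r_lfun.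
  by rewrite f2mx_pow dimvf linear0.
have pW v : v \in W -> p v = v.
  by rewrite memW => /eqP/PW vP; apply: v2r_inj; rewrite v2r_lfun.
have Wp v : p v \in W by rewrite memW v2r_lfun -mulmxA PMn mulmx0.
have Ep : equivariant_end A p.
  move=> s; apply: f2mx_inj; rewrite !f2mx_comp -(Pcomm (f2mx (A s)))//.
  by rewrite -equivariant_f2mx.
(* Non-invertibility of [f] ensures that the generalized kernel, and with it [P], is nonzero. *)
have [v0 v00 fv0] : exists2 v, v != 0 & f v = 0.
  by apply: det_f2mx0; apply: contra_notP fb => /eqP; exact: det_f2mx_bijective.
have v0W : v0 \in W.
  have vM : v2r v0 *m f2mx f = 0 by rewrite -v2r_lfun fv0 linear0.
  rewrite memW; move: (f2mx f) (v2r v0) vM; case: (dim U) => [|n] M v vM.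
    by apply/eqP; exact: thinmx0.
  by rewrite exprS -mulmxE mulmxA vM mul0mx.
have P0 : P != 0.
  apply: contra_neq v00 => P0; rewrite -(pW _ v0W); apply: v2r_inj.
  by rewrite v2r_lfun [f2mx p]P0 mulmx0 linear0.
apply: scalar_nilpotent_absolutely_indecomposable.
  move=> W0; move: v00; rewrite -(vsprojK v0W).
  have : vsproj W v0 \in {:subvs_of W}%VS by exact: memvf.
  by rewrite W0 memv0 => /eqP ->; rewrite linear0 eqxx.
move=> g Eg.
have [J JE] : {J : 'End(U) | forall v, J v = vsval (g (vsproj W (p v)))}.
  exists (linfun vsval \o g \o linfun (vsproj W) \o p)%VF => v.
  by rewrite !comp_lfunE !lfunE.
have EJ : equivariant_end A J.
  move=> s; apply/lfunP => v; rewrite !comp_lfunE !JE.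
  have /lfunP/(_ v) := Ep s; rewrite !comp_lfunE => ->.
  have -> : vsproj W (A s (p v)) = restriction A W s (vsproj W (p v)).
    apply: val_inj; rewrite /= restrictionE// !vsprojK//.
    by apply: (subvP (AW s)); rewrite memv_img.
  by rewrite -[g _]comp_lfunE Eg [X in vsval X]comp_lfunE restrictionE.
have pJ : (p \o J)%VF = J.
  by apply/lfunP => v; rewrite comp_lfunE pW// JE subvsP.
have Jp : (J \o p)%VF = J.
  by apply/lfunP => v; rewrite comp_lfunE !JE (pW (p v)).
have [||e|a Ja] := @max_eigs_scalar_nilpotent _ _ (f2mx f) P (f2mx J)
    PP (Pcomm _ erefl) PMn P0.
- by rewrite -[P]/(f2mx p) -f2mx_comp Jp.
- by rewrite -[P]/(f2mx p) -f2mx_comp pJ.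
- rewrite -[P]/(f2mx p) -f2mx_comp -f2mxB -f2mxZ -f2mxD; apply: maxf.
  apply: equivariant_endD; last exact: equivariant_endZ.
  by apply: equivariant_endB => //; exact: equivariant_end_comp.
exists a, (dim U); apply/lfunP => w; rewrite zero_lfunE; apply: val_inj.
(* On the generalized kernel [p] is the identity, so [J - a *: p] acts there as [g - a]. *)
have powE k : vsval (lfun_pow (g - a *: \1%VF) k w) =
    lfun_pow (J - a *: p) k (vsval w).
  elim: k => [|k IH]; first by rewrite !id_lfunE.
  rewrite !lfun_powS -IH; set u := lfun_pow _ k w.
  rewrite !(add_lfunE, opp_lfunE, scale_lfunE, id_lfunE) JE.
  by rewrite (pW (vsval u)) ?subvsP// vsvalK linearB/= linearZ.
rewrite /= powE; apply: v2r_inj; rewrite v2r_lfun f2mx_pow f2mxB f2mxZ.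
by rewrite -[f2mx p]/P Ja mulmx0 !linear0.
Qed.

End GeneralizedKernel.

(** * Families of equivariant vector fields *)

Section FiniteDimension.
Context {R : realType} {V : finNormedModType R}.

Lemma continuous_rV_linear n (W : normedModType R) (h : {linear 'rV[R]_n -> W}) :
  continuous h.
Proof.
rewrite (_ : (h : _ -> _) = fun x => \sum_(i < n) x 0 i *: h (delta_mx 0 i)).
  apply: continuous_big => [|i _ x]; first exact: add_continuous.
  exact: (cvgZ (@coord_continuous R 1 n 0 i x) (cvg_cst _)).
apply/funext => x; rewrite [in LHS](row_sum_delta x) linear_sum.
by apply: eq_bigr => i _; rewrite linearZ.
Qed.

(** Equivalence of norms: the norm of [V] attains a positive minimum on the compact unit sphere of
    the coordinate space, which is empty in dimension zero. *)
Lemma v2r_bounded : exists M : R, forall v : V, `|v2r v| <= M * `|v|.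
Proof.
pose S : set 'rV[R]_(dim V) := [set x | `|x| = 1].
have cS : compact S.
  apply: bounded_closed_compact.
    exists 1; split=> // M M1 x /= ->; exact: ltW.
  rewrite (_ : S = (fun x => `|x|) @^-1` [set 1])//.
  by apply: closed_comp => [x _|]; [exact: norm_continuous|exact: closed_eq].
have S1 (x : 'rV[R]_(dim V)) : x != 0 -> S (`|x|^-1 *: x).
  by move=> x0; rewrite /S/= normrZ normfV normr_id mulVf ?normr_eq0.
have [S0|/set0P SN0] := eqVneq S set0.
  exists 0 => v; rewrite mul0r normr_le0; apply/eqP/eqP/negPn/negP => /S1.
  by rewrite S0.
have r2vc : {within S, continuous (fun x => `|(r2v x : V)|)}.
  apply: continuous_subspaceT => x; apply: continuous_comp.
    exact: continuous_rV_linear.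
  exact: norm_continuous.
have [c /set_mem cin cmin] := compact_EVT_min SN0 cS r2vc.
have c0 : 0 < `|r2v c : V|.
  rewrite normr_gt0; apply/eqP => c0; move: cin.
  by rewrite /S/= -[c]r2vK c0 linear0 normr0 => /esym/eqP; rewrite oner_eq0.
exists (`|r2v c : V|^-1) => v; have [->|v0] := eqVneq v 0.
  by rewrite linear0 !normr0 mulr0.
have x0 : v2r v != 0 by rewrite -(inj_eq (@v2r_inj _ _)) linear0 in v0 *.
have := cmin _ (mem_set (S1 _ x0)); rewrite linearZ/= v2rK normrZ normfV normr_id.
by rewrite ler_pdivlMl ?normr_gt0// (ler_pdivlMl _ _ c0) mulrC.
Qed.

Lemma continuous_v2r : continuous (v2r : V -> 'rV[R]_(dim V)).
Proof.
have [M vM] := v2r_bounded; apply: bounded_linear_continuous.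
apply/linear_boundedP; near=> r => v.
by rewrite (le_trans (vM v))// ler_wpM2r//; near: r; exact: nbhs_pinfty_ge.
Unshelve. all: by end_near. Qed.

Lemma continuous_fin_linear (W : normedModType R) (h : {linear V -> W}) :
  continuous h.
Proof.
have -> : (h : _ -> _) = (h \o r2v) \o v2r by apply/funext => v; rewrite /= v2rK.
move=> v; apply: continuous_comp; first exact: continuous_v2r.
exact: (@continuous_rV_linear _ _ (h \o r2v)).
Qed.

End FiniteDimension.

(** * Linearizations of a smooth equivariant family *)

Section Linearizations.
Context {R : realType} {V : finNormedModType R}.
Implicit Types (F : V * R -> V) (v x : V) (l : R).

Lemma is_diff_pairl x l :
  is_diff x (fun y : V => (y, l)) (fun v => (v, 0)).
Proof. exact: is_diff_pair. Qed.

Lemma is_diff_pairr x l :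
  is_diff l (fun l : R => (x, l)) (fun l => (0, l)).
Proof. exact: is_diff_pair. Qed.

Lemma differentiable_pairl x l : differentiable (fun y : V => (y, l)) x.
Proof. by have [] := is_diff_pairl x l. Qed.

Lemma differentiable_pairr x l : differentiable (fun l : R => (x, l)) l.
Proof. by have [] := is_diff_pairr x l. Qed.

(** Expresses linearizations through [iter_derive], in terms of which smoothness and the topology
    are defined. *)
Lemma linearizationE x0 F l v : differentiable F (x0, l) ->
  linearization x0 F l v = 'D_(v, 0) F (x0, l).
Proof.
move=> dF; rewrite lfunE deriveE//=.
rewrite (_ : (fun x : V => F (x, l)) = F \o (fun y => (y, l)))//.
rewrite diff_comp; [|exact: differentiable_pairl|by []].
rewrite /=; have H := is_diff_pairl x0 l; by rewrite diff_val.
Qed.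

(** Chain rule for [f \o A s = A s \o f] at [x0], which [A s] fixes. *)
Lemma linearization_equivariant {S : monoidType} (A : S -> 'End(V)) x0 F l :
  (forall s, A s x0 = x0) -> equivariant_families A x0 F ->
  equivariant_end A (linearization x0 F l).
Proof.
move=> Ax0 [sF eF _] s; apply/lfunP => v; rewrite !comp_lfunE !lfunE/=.
pose f y := F (y, l).
have df : differentiable f x0.
  apply: (@differentiable_comp _ _ _ _ (fun y => (y, l)) F).
    exact: differentiable_pairl.
  exact: (sF [::]).
have Ac : continuous (A s) by exact: continuous_fin_linear.
have dA x : differentiable (A s) x by exact: linear_differentiable.
have dfA : differentiable f (A s x0) by rewrite Ax0.
have e1 : 'd (f \o A s) x0 v = 'd f x0 (A s v).
  have -> := diff_comp (dA x0) dfA.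
  by rewrite /= (diff_lin x0 Ac) [in 'd f _]Ax0.
have e2 : 'd (A s \o f) x0 v = A s ('d f x0 v).
  have -> := diff_comp df (dA (f x0)).
  by rewrite /= (diff_lin (f x0) Ac).
rewrite -[LHS]e1 -[RHS]e2; congr ('d _ _ _).
by apply/funext => y; rewrite /f/= eF.
Qed.

Lemma f2mx_coord (f : 'End(V)) i j :
  f2mx f i j = v2r (f (r2v (delta_mx 0 i))) 0 j.
Proof. by rewrite v2r_lfun r2vK -rowE mxE. Qed.

(** An entry is a coordinate of [D_(v, 0) F] along [(x0, l)]; its derivative in [l] is the same
    coordinate of [D_(0, 1) D_(v, 0) F], which is continuous. *)
Lemma C1_linearization x0 F i j : smooth F ->
  C1 (fun l => f2mx (linearization x0 F l) i j).
Proof.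
move=> sF; pose v : V * R := (r2v (delta_mx 0 i), 0).
have [k kE] : {k : {linear V -> R} | forall y, k y = v2r y 0 j}.
  have kl : linear (fun y : V => v2r y 0 j : R).
    by move=> a y z; rewrite linearP !mxE.
  pose k : {linear V -> R} := HB.pack (fun y : V => v2r y 0 j : R)
    (GRing.isLinear.Build _ _ _ _ _ kl).
  by exists k.
have kc : continuous k by exact: continuous_fin_linear.
pose H := iter_derive F [:: v].
have dH q : differentiable H q by exact: (sF [:: v]).
have LE : (fun l => f2mx (linearization x0 F l) i j) = fun l => k (H (x0, l)).
  apply/funext => l; rewrite f2mx_coord kE linearizationE//.
  exact: (sF [::]).
have dkH l : differentiable (k \o (H \o (fun l : R => (x0, l)))) l.
  apply: differentiable_comp; last exact: linear_differentiable.
  by apply: differentiable_comp => //; exact: differentiable_pairr.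
have dE : derive1 (fun l => k (H (x0, l))) =
    fun l => k (iter_derive F [:: (0, 1); v] (x0, l)).
  apply/funext => l; rewrite derive1E' //.
  rewrite (_ : (fun l => k (H (x0, l))) = k \o (H \o (fun l : R => (x0, l))))//.
  have dHp : differentiable (H \o (fun l : R => (x0, l))) l.
    by apply: differentiable_comp => //; exact: differentiable_pairr.
  have -> := diff_comp dHp (linear_differentiable _ kc).
  rewrite (diff_lin _ kc)/=; have -> := diff_comp (@differentiable_pairr x0 l) (dH _).
  by have dp := is_diff_pairr x0 l; rewrite /= diff_val -deriveE.
rewrite LE; split=> [l|].
  by apply/derivable1_diffP; exact: dkH.
rewrite dE => l; apply: (@continuous_comp _ _ _
  (fun l => iter_derive F [:: (0, 1); v] (x0, l)) k).
  apply: (@continuous_comp _ _ _ (fun l => (x0, l)) (iter_derive F [:: (0, 1); v])).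
    exact/differentiable_continuous/differentiable_pairr.
  by apply: differentiable_continuous; exact: sF.
exact: kc.
Qed.

End Linearizations.

(** * Perturbations that are affine in [x] and constant in the parameter *)

Section AffinePerturbations.
Context {R : realType} {V : finNormedModType R}.
Variable x0 : V.
Implicit Types (f g : 'End(V)) (F G : V * R -> V).

(** Vanishes at [x0] for every parameter and shifts all linearizations by the same [f]. *)
Definition affine_family f : V * R -> V := fun q => f (q.1 - x0).

Lemma is_diff_affine_family f q :
  is_diff q (affine_family f) (fun w : V * R => f w.1).
Proof.
pose h (w : V * R) : V := f w.1.
have hl : linear h by move=> a y z; rewrite /h linearP.
pose hL : {linear (V * R)%type -> V} := HB.pack h (GRing.isLinear.Build _ _ _ _ h hl).
have hc : continuous hL.
  move=> w; apply: (@continuous_comp _ _ _ fst f); first exact: cvg_fst.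
  exact: continuous_fin_linear.
have dh : is_diff q h h.
  by split; [exact: (@linear_differentiable _ _ _ hL)|exact: (@diff_lin _ _ _ hL)].
have -> : affine_family f = h + cst (- f x0).
  by apply/funext => w; rewrite /affine_family linearB.
by apply: is_diff_eq; rewrite subr0.
Qed.

Lemma iter_derive_cons F v vs :
  iter_derive F (v :: vs) = 'D_v (iter_derive F vs).
Proof. by []. Qed.

Lemma iter_derive_affine_family f vs :
  iter_derive (affine_family f) vs =
  if vs is v :: vs' then if vs' is [::] then cst (f v.1) else cst 0
  else affine_family f.
Proof.
elim: vs => [//|v vs IH]; rewrite iter_derive_cons IH.
apply/funext => q; case: vs {IH} => [|w [|? ?]]; rewrite ?derive_cst//.
by have H := is_diff_affine_family f q; rewrite deriveE// diff_val.
Qed.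

Lemma smooth_affine_family f : smooth (affine_family f).
Proof.
move=> vs q; rewrite iter_derive_affine_family.
by case: vs => [|v []]//; have [] := is_diff_affine_family f q.
Qed.

Lemma iter_deriveD F G vs : smooth F -> smooth G ->
  iter_derive (F + G) vs = iter_derive F vs + iter_derive G vs.
Proof.
move=> sF sG; elim: vs => [//|v vs IH]; rewrite iter_derive_cons IH; apply/funext => q.
by rewrite deriveD//; apply: diff_derivable; [exact: sF|exact: sG].
Qed.

Lemma smoothD F G : smooth F -> smooth G -> smooth (F + G).
Proof.
move=> sF sG vs q; rewrite iter_deriveD//; apply: differentiableD.
  exact: sF.
exact: sG.
Qed.

Lemma equivariant_families_affine {S : monoidType} (A : S -> 'End(V)) F f :
  (forall s, A s x0 = x0) -> equivariant_end A f ->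
  equivariant_families A x0 F -> equivariant_families A x0 (F + affine_family f).
Proof.
move=> Ax0 Ef [sF eF F0]; split=> [|s x l|l].
- by apply: smoothD => //; exact: smooth_affine_family.
- rewrite !fctE eF linearD/=; congr (_ + _); rewrite /affine_family/=.
  rewrite -{1}(Ax0 s) -linearB/=.
  by have /lfunP/(_ (x - x0)) := Ef s; rewrite !comp_lfunE.
- by rewrite fctE F0 add0r /affine_family/= subrr linear0.
Qed.

Lemma linearization_affine F f l : smooth F ->
  linearization x0 (F + affine_family f) l = linearization x0 F l + f.
Proof.
move=> sF; have sf := @smooth_affine_family f.
apply/lfunP => v; rewrite add_lfunE (linearizationE _ (smoothD sF sf [::] _)).
rewrite (linearizationE _ (sF [::] _)) deriveD.
- congr (_ + _); have H := is_diff_affine_family f (x0, l).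
  by rewrite deriveE// diff_val.
- exact/diff_derivable/(sF [::]).
- exact/diff_derivable/(sf [::]).
Qed.

End AffinePerturbations.

(** * Entrywise convergence of matrices, traces and determinants *)

Section MatrixConvergence.
Context {R : realType} {T : Type} (F : set_system T) {FF : Filter F}.

Lemma mulmx_cvg m n p (M : T -> 'M[R]_(m, n)) (N : T -> 'M[R]_(n, p))
    (M0 : 'M[R]_(m, n)) (N0 : 'M[R]_(n, p)) :
  (forall i j, M t i j @[t --> F] --> M0 i j) ->
  (forall i j, N t i j @[t --> F] --> N0 i j) ->
  forall i j, (M t *m N t) i j @[t --> F] --> (M0 *m N0) i j.
Proof.
move=> MM0 NN0 i j; under eq_cvg do rewrite mxE; rewrite mxE.
by apply: cvg_big => [|k _]; [exact: add_continuous|exact: cvgM].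
Qed.

Lemma expmx_cvg n (M : T -> 'M[R]_n) (M0 : 'M[R]_n) k :
  (forall i j, M t i j @[t --> F] --> M0 i j) ->
  forall i j, (M t ^+ k) i j @[t --> F] --> (M0 ^+ k) i j.
Proof.
move=> MM0; elim: k => [|k IH] i j.
  by under eq_cvg do rewrite expr0; exact: cvg_cst.
by under eq_cvg do rewrite exprS; rewrite exprS; exact: mulmx_cvg.
Qed.

Lemma mxtrace_cvg n (M : T -> 'M[R]_n) (M0 : 'M[R]_n) :
  (forall i j, M t i j @[t --> F] --> M0 i j) ->
  \tr (M t) @[t --> F] --> \tr M0.
Proof. by move=> MM0; apply: cvg_big => [|k _]; [exact: add_continuous|]. Qed.

Lemma det_cvg n (M : T -> 'M[R]_n) (M0 : 'M[R]_n) :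
  (forall i j, M t i j @[t --> F] --> M0 i j) ->
  \det (M t) @[t --> F] --> \det M0.
Proof.
move=> MM0; apply: cvg_big => [|s _]; first exact: add_continuous.
apply: cvgM; first exact: cvg_cst.
by apply: cvg_big => [|k _]; [exact: mul_continuous|].
Qed.

Lemma hankel_cvg m n (M : T -> 'M[R]_n) (M0 : 'M[R]_n) :
  (forall i j, M t i j @[t --> F] --> M0 i j) ->
  hankel m (M t) @[t --> F] --> hankel m M0.
Proof.
move=> MM0; apply: det_cvg => i j; under eq_cvg do rewrite mxE.
by rewrite mxE; apply/mxtrace_cvg/expmx_cvg.
Qed.

End MatrixConvergence.

Lemma cvg_initial {S : choiceType} {T : topologicalType} (f : S -> T)
    (G : set_system S) (s : S) : Filter G ->
  f @ G --> f s -> G --> (s : initial_topology f).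
Proof.
move=> FG fG A /= [_ [[B Bop <-] Bfs sBfA]].
have /fG GB : nbhs (f s) B by apply: open_nbhs_nbhs.
exact: filterS sBfA GB.
Qed.

Lemma cvg_prod_topology {I : Type} {K : I -> topologicalType}
    (G : set_system (prod_topology K)) (g : prod_topology K) : Filter G ->
  (forall i, (fun h : prod_topology K => h i) @ G --> g i) -> G --> g.
Proof. by move=> FG Gg; apply/cvg_sup => i; apply: cvg_initial. Qed.

(** * Openness and density in the space of equivariant families *)

Section FamilyTopology.
Context {R : realType} {S : monoidType} {V : finNormedModType R}.
Variables (A : S -> 'End(V)) (x0 : V).
Hypothesis Ax0 : forall s, A s x0 = x0.
Implicit Types (vs : seq (V * R)) (F : family_space A x0) (l e : R).

Let smooth_family F : smooth (set_val F).
Proof. by have [] := set_valP F. Qed.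

Lemma near_iter_derive F vs (K : set (V * R)) e : compact K -> 0 < e ->
  \forall G \near F, forall q, K q ->
    `|iter_derive (set_val F) vs q - iter_derive (set_val G) vs q| < e.
Proof.
move=> cK e0.
have Fc : (fun G : family_space A x0 => all_derivatives G vs) @ F -->
    (all_derivatives F vs : {family compact, (V * R)%type -> V}).
  have h1 := @initial_continuous _ _ (@all_derivatives _ _ _ A x0) F.
  have h2 := @proj_continuous _ (fun _ : seq (V * R) =>
    {family compact, (V * R)%type -> V}) vs (all_derivatives F).
  exact: (cvg_comp _ _ h1 h2).
have FK : nbhs F [set G : family_space A x0 | forall q, K q ->
    ball (iter_derive (set_val F) vs q) e (iter_derive (set_val G) vs q)].
  exact: (Fc _ (@fam_nbhs _ _ compact K _ (all_derivatives F vs)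
    (entourage_ball V (PosNum e0)) cK)).
by apply: filterS FK => G H q /H; rewrite -ball_normE.
Qed.

(** Joint continuity in the parameter and the family: uniform closeness on the compact segment [K]
    around [(x0, l)] is combined with continuity of the derivatives of [F] itself. *)
Lemma cvg_iter_derive F vs l :
  iter_derive (set_val p.2) vs (x0, p.1) @[p --> (l, F)] -->
    iter_derive (set_val F) vs (x0, l).
Proof.
apply/cvgrPdist_lt => e e0.
have e20 : 0 < e / 2 by rewrite divr_gt0.
pose K := (fun m : R => (x0, m)) @` `[l - 1, l + 1]%classic.
have cK : compact K.
  apply: continuous_compact; last exact: segment_compact.
  apply: continuous_subspaceT => m.
  exact/differentiable_continuous/differentiable_pairr.
have cF : (fun m : R => iter_derive (set_val F) vs (x0, m)) @ l -->
    iter_derive (set_val F) vs (x0, l).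
  apply: (@continuous_comp _ _ _ (fun m => (x0, m)) (iter_derive (set_val F) vs)).
    exact/differentiable_continuous/differentiable_pairr.
  by apply: differentiable_continuous; exact: smooth_family.
exists ([set m | `|iter_derive (set_val F) vs (x0, l) -
      iter_derive (set_val F) vs (x0, m)| < e / 2] `&` `[l - 1, l + 1]%classic,
    [set G : family_space A x0 | forall q, K q ->
      `|iter_derive (set_val F) vs q - iter_derive (set_val G) vs q| < e / 2]).
  split=> /=; last exact: near_iter_derive.
  apply: filterI; first by move/cvgrPdist_lt : cF; exact.
  apply: filterS (nbhsx_ballx l 1 ltr01) => m.
  by rewrite /ball/= in_itv/= ltr_norml; lra.
move=> [m G] /= [[lm mK] GK].
rewrite (splitr e) -(subrKA (iter_derive (set_val F) vs (x0, m))).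
by rewrite (le_lt_trans (ler_normD _ _))// ltrD// GK//; exists m.
Qed.

Let Lmx F l := f2mx (linearization x0 (set_val F) l).

Lemma cvg_linearization F l i j :
  Lmx p.2 p.1 i j @[p --> (l, F)] --> Lmx F l i j.
Proof.
pose v : V * R := (r2v (delta_mx 0 i), 0).
have LE G m : Lmx G m i j = v2r (iter_derive (set_val G) [:: v] (x0, m)) 0 j.
  by rewrite /Lmx f2mx_coord linearizationE//; exact: (@smooth_family G [::]).
rewrite LE; under eq_cvg do rewrite LE.
have c1 := @cvg_iter_derive F [:: v] l.
have c2 := @continuous_v2r _ V (iter_derive (set_val F) [:: v] (x0, l)).
exact: (cvg_comp _ _ (cvg_comp _ _ c1 c2) (@coord_continuous R 1 _ 0 j _)).
Qed.

(** The condition is the non-vanishing of the sum of squares [phi], jointly continuous in [l] and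
    [F]; over the compact interval of [l] it is therefore an open condition on [F]. *)
Lemma open_nonzero_hankel_or_det m (c : R) :
  open [set F : family_space A x0 | forall l, `|l| <= c ->
    hankel m (Lmx F l) != 0 \/ \det (Lmx F l) != 0].
Proof.
rewrite openE => F /= FP; rewrite /interior.
pose phi (M : 'M[R]_(dim V)) := hankel m M * hankel m M + \det M * \det M.
have phiP M : (hankel m M != 0 \/ \det M != 0) <-> phi M != 0.
  rewrite /phi -!expr2 paddr_eq0 ?sqr_ge0// !sqrf_eq0 negb_and.
  by split=> [/orP//|/orP].
have cK : compact `[- c, c]%classic by exact: segment_compact.
suff FK : nbhs F [set G : family_space A x0 |
    `[- c, c]%classic `<=` (fun l => phi (Lmx G l) != 0)].
  apply: filterS FK => G H l lc; apply/phiP/H.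
  by rewrite /= in_itv/= -ler_norml.
move/compact_near_coveringP : cK => /(_ (family_space A x0) (nbhs F)
  (fun G l => phi (Lmx G l) != 0) (nbhs_filter F)); apply => l lc.
have Fl0 : phi (Lmx F l) != 0.
  by apply/phiP/FP; move: lc; rewrite /= in_itv/= -ler_norml.
have cphi : phi (Lmx p.2 p.1) @[p --> (l, F)] --> phi (Lmx F l).
  have FF : Filter (nbhs (l, F)) by exact: nbhs_filter.
  have ch := @hankel_cvg _ _ _ FF m _ _ _ (@cvg_linearization F l).
  have cd := @det_cvg _ _ _ FF _ _ _ (@cvg_linearization F l).
  exact: (cvgD (cvgM ch ch) (cvgM cd cd)).
exact: (cphi [set x | x != 0] (open_nbhs_nbhs (conj (open_neq (y := 0)) Fl0))).
Qed.

Let add_affine F f (Ef : equivariant_end A f) : family_space A x0 :=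
  SigSub (mem_set (equivariant_families_affine Ax0 Ef (set_valP F))).

Let add_affineE F f (Ef : equivariant_end A f) :
  set_val (add_affine F Ef) = set_val F + affine_family x0 f.
Proof. by []. Qed.

Let Lmx_add_affine F f (Ef : equivariant_end A f) l :
  Lmx (add_affine F Ef) l = Lmx F l + f2mx f.
Proof. by rewrite /Lmx add_affineE linearization_affine// f2mxD. Qed.

Let equivariant_combination (f : 'End(V)) (Ef : equivariant_end A f) (c s : R) :
  equivariant_end A (c *: f + s *: \1%VF).
Proof.
by apply: equivariant_endD; apply: equivariant_endZ => //; exact: equivariant_end1.
Qed.

Lemma compact_bounded_iter_derive (f : 'End(V)) vs (K : set (V * R)) :
  compact K -> exists2 B : R, 0 < B &
    forall q, K q -> `|iter_derive (affine_family x0 f) vs q| <= B.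
Proof.
move=> cK; set h := iter_derive _ vs.
have hc : continuous h.
  by move=> q; apply/differentiable_continuous/smooth_affine_family.
have /compact_bounded[M [_ hM]] : compact (h @` K).
  by apply: continuous_compact cK; exact: continuous_subspaceT.
exists (`|M| + 1) => [|q Kq]; first by rewrite ltr_pwDr.
apply: (hM (`|M| + 1)); last by exists q.
by rewrite (le_lt_trans (ler_norm _))// ltrDl.
Qed.

(** The iterated derivatives of the perturbation are, on each compact set, bounded by a constant
    times the sum of the absolute values of the two coefficients. *)
Lemma cvg_add_affine F f (Ef : equivariant_end A f) :
  add_affine F (equivariant_combination Ef p.1 p.2) @[p --> ((0, 0) : R * R)] --> F.
Proof.
apply: cvg_initial; apply: cvg_prod_topology => vs.
apply/fam_cvgP => K cK U /uniform_nbhs[E [entE EU]].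
have [e e0 eE] : exists2 e : R, 0 < e & forall x y : V, `|x - y| < e -> E (x, y).
  move: entE; rewrite -entourage_ballE => -[e e0 eE]; exists e => // x y xy.
  by apply: eE; rewrite /= -ball_normE.
have [B [B0 fB]] : exists B : R, 0 < B /\ forall g q, K q ->
    forall a b, g = a *: f + b *: \1%VF ->
    `|iter_derive (affine_family x0 g) vs q| <= (`|a| + `|b|) * B.
  have [B1 B10 fB1] := compact_bounded_iter_derive f vs cK.
  have [B2 B20 fB2] := compact_bounded_iter_derive \1%VF vs cK.
  exists (B1 + B2); split=> [|g q Kq a b ->]; first exact: addr_gt0.
  have -> : iter_derive (affine_family x0 (a *: f + b *: \1%VF)) vs q =
      a *: iter_derive (affine_family x0 f) vs q +
      b *: iter_derive (affine_family x0 \1%VF) vs q.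
    rewrite !iter_derive_affine_family /affine_family.
    by case: (vs) => [|v [|? ?]]; rewrite ?scaler0 ?addr0//= add_lfunE
      !scale_lfunE.
  rewrite (le_trans (ler_normD _ _))// !normrZ mulrDl.
  apply: lerD; rewrite ler_wpM2l//.
    by rewrite (le_trans (fB1 q Kq))// lerDl ltW.
  by rewrite (le_trans (fB2 q Kq))// lerDr ltW.
have near0 : \forall p \near ((0, 0) : R * R), `|p.1| + `|p.2| < e / B.
  apply/nbhs_ballP; exists (e / B / 2) => /=; first by rewrite !divr_gt0.
  move=> [a b] [] /=; rewrite /ball/= !sub0r !normrN => ae be.
  by rewrite (splitr (e / B)) ltrD.
apply: filterS near0 => p pe; apply: EU => q Kq; apply: eE.
rewrite /all_derivatives add_affineE iter_deriveD//; last exact: smooth_affine_family.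
rewrite fctE opprD addNKr normrN (le_lt_trans (fB _ _ Kq _ _ erefl))//.
by rewrite -ltr_pdivlMr.
Qed.

(** [generic_affine_perturbation] applies to the path of linearizations of [F], since every
    [f0 + x L] is equivariant and has at most [m] eigenvalues. *)
Lemma dense_nonzero_hankel_or_det m (f0 : 'End(V)) (c : R) :
  size (eigs (f2mx f0)) = m -> equivariant_end A f0 ->
  (forall g, equivariant_end A g -> (size (eigs (f2mx g)) <= m)%N) ->
  dense [set F : family_space A x0 | forall l, `|l| <= c ->
    hankel m (Lmx F l) != 0 \/ \det (Lmx F l) != 0].
Proof.
move=> szf0 Ef0 maxm O [F OF] oO.
have /(cvg_add_affine Ef0) /nbhs_ballP[e /= e0 eO] : nbhs F O by exact: open_nbhs_nbhs.
have C1L i j : C1 (fun l => Lmx F l i j) by exact: C1_linearization.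
have EL l : equivariant_end A (linearization x0 (set_val F) l).
  exact: linearization_equivariant (set_valP F).
have maxL l x : (size (eigs (f2mx f0 + x *: Lmx F l)) <= m)%N.
  rewrite -f2mxZ -f2mxD; apply: maxm.
  by apply: equivariant_endD => //; exact: equivariant_endZ.
have [a [s [ae se LP]]] := generic_affine_perturbation szf0 C1L maxL e0.
exists (add_affine F (equivariant_combination Ef0 a s)); split.
  by apply: (eO (a, s)); split; rewrite /= /ball/= sub0r normrN.
move=> l _; rewrite Lmx_add_affine f2mxD !f2mxZ f2mx1 scalemx1 addrA.
exact: LP.
Qed.

End FamilyTopology.

(** * Maximal number of eigenvalues and the residual set *)

Lemma bounded_nat_max (T : Type) (P : set T) (N : T -> nat) (b : nat) :
  P !=set0 -> (forall x, (N x <= b)%N) ->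
  exists2 x, P x & forall y, P y -> (N y <= N x)%N.
Proof.
move=> [x0 Px0] Nb; pose Q k := `[< exists2 x, P x & N x = k >].
have exQ : exists k, Q k by exists (N x0); apply/asboolP; exists x0.
have ubQ k : Q k -> (k <= b)%N by move=> /asboolP[x _ <-].
case: (ex_maxnP exQ ubQ) => k /asboolP[x Px <-] maxk.
by exists x => // y Py; apply: maxk; apply/asboolP; exists y.
Qed.

Theorem mainTheorem1 (R : realType) (S : monoidType) (V : finNormedModType R)
    (A : S -> 'End(V)) (x0 : V) :
  representation A ->
  (forall s : S, A s x0 = x0) ->
  residual [set F : family_space A x0 |
    forall l0 : R,
      let L := linearization x0 (set_val F) l0 in
      ~ bijective L ->
      subrepresentation A (generalized_kernel L) /\
      absolutely_indecomposable (restriction A (generalized_kernel L))].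
Proof.
move=> _ Ax0; have [f0 Ef0 maxf0] := bounded_nat_max
  (ex_intro _ \1%VF (@equivariant_end1 _ _ _ A)) (fun f => size_eigs (f2mx f)).
have {maxf0}[m szf0 maxf0] : exists2 m, size (eigs (f2mx f0)) = m &
    forall g, equivariant_end A g -> (size (eigs (f2mx g)) <= m)%N.
  by exists (size (eigs (f2mx f0))).
(* Openness rests on compactness of the parameter range, hence one condition for each interval of
   radius [i]; together they cover all parameters. *)
exists (fun i : nat => [set F : family_space A x0 | forall l, `|l| <= i%:R ->
  hankel m (f2mx (linearization x0 (set_val F) l)) != 0 \/
  \det (f2mx (linearization x0 (set_val F) l)) != 0]).
split=> [i|F OF l0 L Lb].
  split; first exact: open_nonzero_hankel_or_det.
  exact: (@dense_nonzero_hankel_or_det _ _ _ A x0 Ax0 m f0 i%:R szf0 Ef0 maxf0).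
have EL : equivariant_end A L.
  exact: linearization_equivariant (set_valP F).
split; first exact: subrepresentation_generalized_kernel.
apply: (max_eigs_generalized_kernel EL _ Lb) => g Eg.
have l0i : `|l0| <= (Num.truncn `|l0|).+1%:R by exact/ltW/truncnS_gt.
(* As [L] is not bijective, its determinant vanishes; so its Hankel determinant does not, and [L]
   attains the maximum [m]. *)
have [hL|dL] := OF _ I l0 l0i; last by case: Lb; exact: det_f2mx_bijective.
have := hL; rewrite (hankel_neq0 (maxf0 L EL)) => /eqP szL.
by apply: (leq_trans (maxf0 g Eg)); rewrite szL.
Qed.
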